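(* The Overlap Extension problem is NP-complete.
   Context: Two sets overlap if they intersect and neither is a subset of the other. An overlap representation of a graph $G=(V,E)$ is a family (multiset) of finite sets $\{S_v : v\in V\}$ such that for all $u,v\in V$, $(u,v)\in E$ iff $S_u\cap S_v\neq\emptyset$, $S_u\not\subseteq S_v$ and $S_v\not\subseteq S_u$. The Overlap Extension problem: Instance: a graph $G=(V,E)$, an overlap representation $\{S_v : v\in V\}$ of $G$ (given by listing the sets), and a set $A\subseteq V$. Question: is there a set $S\subseteq\bigcup_{v\in V}S_v$ such that, for every $v\in V$, $S$ overlaps $S_v$ if and only if $v\in A$? *)

(* Defs.v *)
From mathcomp Require Import all_boot all_algebra finmap.

Set Implicit Arguments.
Unset Strict Implicit.
Unset Printing Implicit Defensive.

Local Open Scope nat_scope.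

(* Deterministic multi-tape Turing machines.                                  *)
(* A two-way infinite tape is stored as the pair of half-tapes on either side *)
(* of the head: [tleft] is listed from the head outwards, [tright] starts     *)
(* with the scanned cell, and every cell past the end of a list is blank.     *)
(* [None] is the blank symbol, so a tape alphabet never contains it.          *)

Record tape (G : Type) := Tape {
  tleft : seq (option G);
  tright : seq (option G)
}.

Inductive move := MoveLeft | Stay | MoveRight.

Definition tape_read (G : Type) (t : tape G) : option G := head None (tright t).

Definition tape_act (G : Type) (t : tape G) (a : option G * move) : tape G :=
  let: (s, m) := a in
  let r := behead (tright t) in
  match m with
  | MoveLeft => Tape (behead (tleft t)) (head None (tleft t) :: s :: r)
  | Stay => Tape (tleft t) (s :: r)
  | MoveRight => Tape (s :: tleft t) r
  end.

Definition blank_tape (G : Type) : tape G := Tape [::] [::].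

Definition word_tape (G : Type) (w : seq G) : tape G := Tape [::] (map Some w).

(* The word read from the head rightwards, up to the first blank. *)
Definition tape_word (G : eqType) (t : tape G) : seq G :=
  pmap id (take (index None (tright t)) (tright t)).

(* Machines with tape alphabet [G] and [(tm_tapes M).+1] tapes. *)
Record TM (G : finType) := MkTM {
  tm_tapes : nat;
  tm_state : finType;
  tm_start : tm_state;
  tm_halt : {pred tm_state};
  tm_accept : {pred tm_state};
  tm_trans : tm_state -> {ffun 'I_tm_tapes.+1 -> option G} ->
             tm_state * {ffun 'I_tm_tapes.+1 -> option G * move}
}.

Record config (G : finType) (M : TM G) := Config {
  cstate : tm_state M;
  ctapes : 'I_(tm_tapes M).+1 -> tape G
}.

(* Halting configurations are fixed points of [tm_step], so being halted      *)
(* after exactly t iterations means having halted within t steps.             *)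
Definition tm_step (G : finType) (M : TM G) (c : config M) : config M :=
  if cstate c \in @tm_halt _ M then c else
  let: (q, act) := tm_trans (cstate c) [ffun i => tape_read (ctapes c i)] in
  Config q (fun i => tape_act (ctapes c i) (act i)).

Definition tm_init (G : finType) (M : TM G) (w : seq G) : config M :=
  Config (tm_start M)
    (fun i => if i == ord0 then word_tape w else blank_tape G).

Definition tm_run (G : finType) (M : TM G) (t : nat) (w : seq G) : config M :=
  iter t (@tm_step G M) (tm_init M w).

Definition halted (G : finType) (M : TM G) (c : config M) : bool :=
  cstate c \in @tm_halt _ M.

Definition accepting (G : finType) (M : TM G) (c : config M) : bool :=
  cstate c \in @tm_accept _ M.

Definition language (Sigma : finType) := seq Sigma -> Prop.

Definition in_P (Sigma : finType) (L : language Sigma) : Prop :=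
  exists (G : finType) (inp : Sigma -> G) (M : TM G) (p : {poly nat}),
    injective inp /\
    forall w : seq Sigma,
      let c := tm_run M p.[size w]%R (map inp w) in
      halted c /\ (accepting c <-> L w).

(* The input is on the first tape and the output on the last one. *)
Definition polytime_computable (Sigma1 Sigma2 : finType)
    (f : seq Sigma1 -> seq Sigma2) : Prop :=
  exists (G : finType) (inp : Sigma1 -> G) (out : Sigma2 -> G)
         (M : TM G) (p : {poly nat}),
    [/\ injective inp, injective out &
    forall w : seq Sigma1,
      let c := tm_run M p.[size w]%R (map inp w) in
      halted c /\ tape_word (ctapes c ord_max) = map out (f w)].

(* Certificates are bit strings. The pair (x, y) is presented to the verifier *)
(* as a word over the disjoint union of the two alphabets.                    *)
Definition in_NP (Sigma : finType) (L : language Sigma) : Prop :=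
  exists (V : language (Sigma + bool)%type) (p : {poly nat}),
    in_P V /\
    forall x : seq Sigma,
      L x <-> exists y : seq bool,
                size y <= p.[size x]%R /\ V (map inl x ++ map inr y).

Definition polytime_reducible (Sigma1 Sigma2 : finType)
    (L1 : language Sigma1) (L2 : language Sigma2) : Prop :=
  exists f : seq Sigma1 -> seq Sigma2,
    polytime_computable f /\ forall w : seq Sigma1, L1 w <-> L2 (f w).

Definition NP_hard (Sigma : finType) (L : language Sigma) : Prop :=
  forall (Sigma' : finType) (L' : language Sigma'),
    in_NP L' -> polytime_reducible L' L.

Definition NP_complete (Sigma : finType) (L : language Sigma) : Prop :=
  in_NP L /\ NP_hard L.

Local Open Scope fset_scope.

Definition overlap (T : choiceType) (A B : {fset T}) : bool :=
  [&& A `&` B != fset0, ~~ (A `<=` B) & ~~ (B `<=` A)].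

Definition overlap_representation (V : finType) (E : rel V) (T : choiceType)
    (S : V -> {fset T}) : Prop :=
  forall u v : V, E u v <-> overlap (S u) (S v).

Definition overlap_extendable (V : finType) (T : choiceType)
    (S : V -> {fset T}) (A : {set V}) : Prop :=
  exists X : {fset T},
    X `<=` \bigcup_(v <- enum V) S v /\
    forall v : V, overlap X (S v) <-> v \in A.

(* Elements of the represented sets are named by arbitrary bit strings. Sets  *)
(* are given by listings, in any order and possibly with repetitions.         *)
Record oe_instance := OEInstance {
  oe_order : nat;
  oe_edge : rel 'I_oe_order;
  oe_listing : 'I_oe_order -> seq (seq bool);
  oe_marked : {set 'I_oe_order};
  oe_edge_sym : symmetric oe_edge;
  oe_edge_irr : irreflexive oe_edge;
  oe_repr : overlap_representation oe_edge
              (fun v => [fset x in oe_listing v])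
}.

Definition oe_set (I : oe_instance) (v : 'I_(oe_order I)) : {fset seq bool} :=
  [fset x in oe_listing v].

Definition oe_yes (I : oe_instance) : Prop :=
  overlap_extendable (@oe_set I) (oe_marked I).

Definition oe_symbol : finType := option (option bool).
Definition bit (b : bool) : oe_symbol := Some (Some b).
Definition comma : oe_symbol := Some None.
Definition hash : oe_symbol := None.

(* The rows of the adjacency matrix, each followed by [hash]; then, for each  *)
(* vertex, the names of the listed elements, each followed by [comma], and a  *)
(* final [hash]; then the characteristic vector of the marked set.            *)
Definition oe_encode (I : oe_instance) : seq oe_symbol :=
  flatten [seq rcons [seq bit (oe_edge u v) | v <- enum 'I_(oe_order I)] hash
          | u <- enum 'I_(oe_order I)] ++
  flatten [seq rcons (flatten [seq rcons (map bit x) comma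
                              | x <- oe_listing v]) hash
          | v <- enum 'I_(oe_order I)] ++
  [seq bit (v \in oe_marked I) | v <- enum 'I_(oe_order I)].

Definition overlap_extension : language oe_symbol :=
  fun w => exists I : oe_instance, w = oe_encode I /\ oe_yes I.

(* Main.v *)
(* Membership in NP: the certificate codes the listings, the marks and the set [X]; the verifier
   re-encodes the instance it describes, compares the result with the input and tests the
   overlaps.  Hardness: acceptance by a deterministic machine with a guessed certificate is turned
   into a CNF formula over "cell p of tape i contains a at time t", where positions are relative
   to the head, so that every tape is always scanned at the same position and one step shifts
   the whole tape.  Apart from the guess and the acceptance condition, the clauses are
   implications between positive facts, so a satisfying assignment makes true every fact of the
   run on the certificate read off from it, without any "at most one symbol" clauses.
   Satisfiability reduces to not-all-equal satisfiability, which is overlap extension with all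
   sets marked: once [X] splits two disjoint pairs, one of which is disjoint from S, it overlaps
   S if and only if it contains some but not all of the elements of S.

   Verifier and reduction come from one calculus: a function on tree-coded data counts as
   polynomial-time if a structured program over stacks computes it, a stack being a half-tape with
   its top under the head.  This class is closed under pairing, case distinction, equality and
   folds whose accumulator stays polynomially bounded, so both can be written as ordinary list
   functions. *)

From mathcomp Require Import all_boot all_algebra finmap zify.
From Stdlib Require Import FunctionalExtensionality.
Require Import Defs.

Set Implicit Arguments.
Unset Strict Implicit.
Unset Printing Implicit Defensive.

Local Open Scope nat_scope.

(** * Stack programs and their compilation to Turing machines *)

Section StackPrograms.
Variable G : finType.

Inductive cmd :=
| Skip
| Push of nat & G
| Pop of nat
| Seq of cmd & cmd
| Case of nat & (option G -> cmd)
| While of nat & cmd.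

Definition store := nat -> seq G.

Definition upd (s : store) i w : store := fun j => if j == i then w else s j.

(** The clock is the exact step count of the compiled machine: a push takes a left move and a write,
    and each test of [Case] or [While] takes one step. *)
Inductive run : cmd -> store -> nat -> store -> Prop :=
| run_skip s : run Skip s 1 s
| run_push i a s : run (Push i a) s 2 (upd s i (a :: s i))
| run_pop i s : run (Pop i) s 1 (upd s i (behead (s i)))
| run_seq c d s t s1 t' s2 :
    run c s t s1 -> run d s1 t' s2 -> run (Seq c d) s (t + t') s2
| run_case i f s t s1 : run (f (ohead (s i))) s t s1 -> run (Case i f) s t.+1 s1
| run_while0 i c s : s i = [::] -> run (While i c) s 1 s
| run_while1 i c s t s1 t' s2 : s i != [::] ->
    run c s t s1 -> run (While i c) s1 t' s2 -> run (While i c) s (t + t').+1 s2.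

(** One unit of time adds at most one symbol, so time bounds yield size bounds. *)
Lemma run_size c s t s' i : run c s t s' -> size (s' i) <= size (s i) + t.
Proof.
elim=> {c s t s'} [s|j a s|j s|c d s t s1 t' s2 _ IH _ IH'|j f s t s1 _ IH|j c s _|j c s t s1 t'
    s2 _ _ IH _ IH'];
  rewrite /upd; try lia; case: eqP => [->|] /=; rewrite ?size_behead; lia.
Qed.

Fixpoint regs c : nat :=
  match c with
  | Skip => 0
  | Push i _ | Pop i => i.+1
  | Seq c d => maxn (regs c) (regs d)
  | Case i f => maxn i.+1 (\max_a regs (f a))
  | While i c => maxn i.+1 (regs c)
  end.

(* [None] is the entry test of [Case] and [While]. *)
Fixpoint control c : finType :=
  match c with
  | Skip | Pop _ => unit
  | Push _ _ => bool
  | Seq c d => (control c + control d)%type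
  | Case _ f => option {a : option G & control (f a)}
  | While _ c => option (control c)
  end.

Fixpoint entry c : control c :=
  match c with
  | Skip | Pop _ => tt
  | Push _ _ => false
  | Seq c d => inl (entry c)
  | Case _ _ | While _ _ => None
  end.

Section Compile.
Variable n : nat.
Notation reads := {ffun 'I_n.+1 -> option G}.
Notation acts := {ffun 'I_n.+1 -> option G * move}.
Notation tapes := ('I_n.+1 -> tape G).

Definition idle (r : reads) : acts := [ffun j => (r j, Stay)].
Definition act1 (r : reads) i x : acts :=
  [ffun j => if j == inord i then x else (r j, Stay)].

Fixpoint control_step c : control c -> reads -> option (control c) * acts :=
  match c return control c -> reads -> option (control c) * acts with
  | Skip => fun _ r => (None, idle r)
  | Push i a => fun q r =>
      if q then (None, act1 r i (Some a, Stay))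
      else (Some true, act1 r i (r (inord i), MoveLeft))
  | Pop i => fun _ r => (None, act1 r i (None, MoveRight))
  | Seq c d => fun q r =>
      match q with
      | inl q => let: (o, a) := control_step q r in
                 (Some (if o is Some q' then inl q' else inr (entry d)), a)
      | inr q => let: (o, a) := control_step q r in (omap inr o, a)
      end
  | Case i f => fun q r =>
      match q with
      | None => (Some (Some (Tagged (fun a => control (f a)) (entry (f (r (inord i)))))),
                 idle r)
      | Some q => let: (o, a) := control_step (tagged q) r in
                  (omap (fun q' => Some (Tagged (fun a => control (f a)) q')) o, a)
      end
  | While i c => fun q r =>
      match q with
      | None => (if r (inord i) is Some _ then Some (Some (entry c)) else None, idle r)
      | Some q => let: (o, a) := control_step q r in (Some o, a)
      end
  end.

Definition rd (ts : tapes) : reads := [ffun i => tape_read (ts i)].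
Definition actall (ts : tapes) (a : acts) : tapes := fun i => tape_act (ts i) (a i).

Section Exits.
Variables (Q : Type) (de : Q -> reads -> option Q * acts).

(** The action of the leaving transition is still performed, so an enclosing machine can redirect
    that transition without spending an extra step. *)
Inductive exits : Q -> tapes -> nat -> tapes -> Prop :=
| exits1 q ts a : de q (rd ts) = (None, a) -> exits q ts 1 (actall ts a)
| exitsS q ts q' a t ts' : de q (rd ts) = (Some q', a) ->
    exits q' (actall ts a) t ts' -> exits q ts t.+1 ts'.
End Exits.

(* [nx] is where the larger machine continues when the embedded one exits. *)
Lemma exits_lift Q Q' (de : Q -> _) (de' : Q' -> _) (h : Q -> Q') (nx : option Q') q ts t ts' :
  (forall q r, de' (h q) r = let: (o, a) := de q r in
     (if o is Some q' then Some (h q') else nx, a)) ->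
  exits de q ts t ts' ->
  (nx = None -> exits de' (h q) ts t ts') /\
  (forall q2 t2 ts2, nx = Some q2 -> exits de' q2 ts' t2 ts2 ->
     exits de' (h q) ts (t + t2) ts2).
Proof.
move=> H; elim=> {q ts t ts'} [q ts a Ha|q ts q' a t ts' Ha _ [IH1 IH2]].
  split=> [E|q2 t2 ts2 E H2]; first by apply: exits1; rewrite H Ha E.
  by apply: exitsS H2; rewrite H Ha E.
split=> [E|q2 t2 ts2 E H2].
  by apply: exitsS (IH1 E); rewrite H Ha.
by rewrite addSn; apply: exitsS (IH2 _ _ _ E H2); rewrite H Ha.
Qed.

(* The scanned cell holds the top of the stack; popping leaves blanks to the left. *)
Definition rep (t : tape G) (w : seq G) : Prop :=
  exists a b, tleft t = nseq a None /\ tright t = map Some w ++ nseq b None.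

Definition reps (ts : tapes) (s : store) : Prop := forall i : 'I_n.+1, rep (ts i) (s i).

Lemma rep_read t w : rep t w -> tape_read t = ohead w.
Proof. by case=> a [b [_ E]]; rewrite /tape_read E; case: w {E} => //=; case: b. Qed.

Lemma rep_idle t w : rep t w -> rep (tape_act t (tape_read t, Stay)) w.
Proof.
case: t => l r [a [b [/= -> ->]]]; rewrite /tape_read /=.
case: w => [|x w] /=; last by exists a, b.
by case: b => [|b]; [exists a, 1 | exists a, b.+1].
Qed.

Lemma rep_pop t w : rep t w -> rep (tape_act t (None, MoveRight)) (behead w).
Proof.
case: t => l r [a [b [/= -> ->]]].
by case: w => [|x w] /=; [exists a.+1, b.-1; case: b | exists a.+1, b].
Qed.

Lemma rep_push t w x : rep t w ->
  rep (tape_act (tape_act t (tape_read t, MoveLeft)) (Some x, Stay)) (x :: w).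
Proof.
case: t => l r [a [b [/= -> ->]]]; rewrite /tape_read /=.
(* With no stored blank on the left, the move uncovers an implicit one; the truncated predecessor
   covers both cases. *)
have -> : behead (nseq a (None : option G)) = nseq a.-1 None by case: a.
case: w => [|y w] /=; last by exists a.-1, b.
by case: b => [|b]; [exists a.-1, 1 | exists a.-1, b.+1].
Qed.

Lemma reps_idle ts s : reps ts s -> reps (actall ts (idle (rd ts))) s.
Proof. by move=> H i; rewrite /actall !ffunE; apply: rep_idle. Qed.

Lemma eq_inord i (j : 'I_n.+1) : i < n.+1 -> (j == inord i) = (j == i :> nat).
Proof. by move=> h; rewrite -val_eqE /= inordK. Qed.

Lemma reps_read ts s i : i < n.+1 -> reps ts s -> rd ts (inord i) = ohead (s i).
Proof. by move=> h H; rewrite ffunE (rep_read (H _)) inordK. Qed.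

(** Induction on the derivation. Control states of subprograms are injected into those of the whole,
    and [exits_lift] chains the pieces with the clock preserved exactly. *)
Lemma compile_run c s t s' ts : run c s t s' -> regs c <= n.+1 -> reps ts s ->
  exists ts', reps ts' s' /\ exits (@control_step c) (entry c) ts t ts'.
Proof.
move=> H; elim: H ts => {c s t s'} [s|j x s|j s|c d s t s1 t' s2 _ IH _ IH'|j f s t s1 _ IH|j c s
    E|j c s t s1 t' s2 E _ IH _ IH'] ts /=.
- by move=> _ H; exists (actall ts (idle (rd ts))); split; [exact: reps_idle | exact: exits1].
- move=> hj H.
  pose ts1 := actall ts (act1 (rd ts) j (rd ts (inord j), MoveLeft)).
  exists (actall ts1 (act1 (rd ts1) j (Some x, Stay))); split; last first.
    by apply: (exitsS (q' := true)) => //; apply: exits1.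
  move=> i; rewrite /upd -(eq_inord _ hj) /ts1 /actall !ffunE.
  case: eqP => [->|_]; last by do 2 apply: rep_idle.
  by move: (H (inord j)); rewrite inordK // => h; apply: rep_push.
- move=> hj H; exists (actall ts (act1 (rd ts) j (None, MoveRight))); split; last exact: exits1.
  move=> i; rewrite /upd -(eq_inord _ hj) /actall !ffunE.
  case: eqP => [->|_]; last exact: rep_idle.
  by move: (H (inord j)); rewrite inordK //; apply: rep_pop.
- rewrite geq_max => /andP[hc hd] H.
  have [ts1 [H1 e1]] := IH _ hc H; have [ts2 [H2 e2]] := IH' _ hd H1.
  exists ts2; split=> //.
  have [|_ L] := @exits_lift _ _ (@control_step c) (@control_step (Seq c d)) inl (Some (inr
      (entry d))) _ _ _ _ _ e1.
    by move=> q r /=; case: control_step => [[]].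
  have [|L' _] := @exits_lift _ _ (@control_step d) (@control_step
      (Seq c d)) inr None _ _ _ _ _ e2.
    by move=> q r /=; case: control_step => [[]].
  exact: L (erefl _) (L' erefl).
- rewrite geq_max => /andP[hj /bigmax_leqP hf] H.
  have [ts1 [H1 e1]] := IH _ (hf _ isT) (reps_idle H).
  exists ts1; split=> //.
  apply: exitsS; first reflexivity; rewrite (reps_read hj H).
  have [|L _] := @exits_lift _ _ (@control_step (f (ohead (s j)))) (@control_step (Case j f))
     (fun q => Some (Tagged (fun a => control (f a)) q)) None _ _ _ _ _ e1; last exact: L.
  by move=> q r /=; case: control_step => [[]].
- rewrite geq_max => /andP[hj hc] H; exists (actall ts (idle (rd ts))); split;
    first exact: reps_idle.
  by apply: exits1; rewrite /= (reps_read hj H) E.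
- rewrite geq_max => /andP[hj hc] H.
  have [ts1 [H1 e1]] := IH _ hc (reps_idle H).
  have [ts2 [H2 e2]] := IH' _ (ltac:(by rewrite /= geq_max hj)) H1.
  exists ts2; split=> //.
  apply: (exitsS (q' := Some (entry c)) (a := idle (rd ts))).
    by rewrite /= (reps_read hj H); case: (s j) E.
  have [|_ L] := @exits_lift _ _ (@control_step c) (@control_step (While j c)) Some
      (Some None) _ _ _ _ _ e1.
    by move=> q r /=; case: control_step => [[]].
  exact: L (erefl _) e2.
Qed.

(* [inr None] tests the top of stack 0 for [g]; [inr (Some b)] halts with answer [b]. *)
Definition machine (g : G) (c : cmd) : TM G :=
  @MkTM G n (control c + option bool)%type (inl (entry c))
    [pred q | if q is inr (Some _) then true else false]
    [pred q | if q is inr (Some b) then b else false]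
    (fun q r => match q with
     | inl q => let: (o, a) := control_step q r in (if o is Some q' then inl q' else inr None, a)
     | inr _ => (inr (Some (r ord0 == Some g)), idle r)
     end).

Lemma machine_exits g c q ts t ts' : exits (@control_step c) q ts t ts' ->
  iter t (@tm_step G (machine g c)) (@Config G (machine g c) (inl q) ts) =
  @Config G (machine g c) (inr None) ts'.
Proof.
elim=> {q ts t ts'} [q ts a Ha|q ts q' a t ts' Ha _ IH].
  by rewrite /= /tm_step /= -/(rd ts) Ha.
by rewrite iterSr {2}/tm_step /= -/(rd ts) Ha.
Qed.

Lemma machine_run g c w t s' T : regs c <= n.+1 ->
  run c (upd (fun=> [::]) 0 w) t s' -> t < T ->
  exists ts, tm_run (machine g c) T w =
    @Config G (machine g c) (inr (Some (ohead (s' 0) == Some g))) ts /\ reps ts s'.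
Proof.
move=> hc H hT.
have R0 : reps (ctapes (tm_init (machine g c) w)) (upd (fun=> [::]) 0 w).
  move=> i; rewrite /= /upd.
  have -> : (i == ord0) = (i == 0 :> nat) by rewrite -val_eqE.
  case: ifP => _; last by exists 0, 0.
  by exists 0, 0; rewrite /= cats0.
have [ts [Hts e]] := compile_run H hc R0.
exists (actall ts (idle (rd ts))); split; last exact: reps_idle.
(* [t] steps for the program and one for testing the answer; the remaining steps are spent in a
   halting state, which [tm_step] fixes. *)
have -> : T = (T - t.+1) + t.+1 by lia.
rewrite /tm_run iterD iterS /tm_init (machine_exits g e).
have -> : tm_step (@Config G (machine g c) (inr None) ts) =
   @Config G (machine g c) (inr (Some (ohead (s' 0) == Some g))) (actall ts (idle (rd ts))).
  by rewrite /tm_step /= -/(rd ts) /actall; congr Config; rewrite ffunE (rep_read (Hts ord0)).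
by elim: (T - t.+1) => //= k ->.
Qed.

Lemma rep_word t w : rep t w -> tape_word t = w.
Proof.
case=> a [b [_ E]]; rewrite /tape_word E index_cat.
have -> : (None \in map Some w) = false by elim: w {E} => //= x w; rewrite inE.
have -> : index (None : option G) (nseq b None) = 0 by case: b {E}.
by rewrite addn0 take_size_cat //; elim: w {E} => //= x w ->.
Qed.

End Compile.
End StackPrograms.

(** * Polynomial-time functions on tree-coded data *)

(** A base of at least 2 makes the powers monotone in both arguments and lets them dominate
    constants, so one exponent records a polynomial bound. *)
Definition pbound k n := (n + 2) ^ k.
Definition polyb (f : nat -> nat) := exists k, forall n, f n <= pbound k n.

Lemma leq_pbound k m n : m <= n -> pbound k m <= pbound k n.
Proof. by case: k => // k h; rewrite leq_exp2r // leq_add2r. Qed.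

Lemma pbound_gt0 k n : 0 < pbound k n.
Proof. by rewrite expn_gt0 addn2. Qed.

Lemma leq_pboundl k l n : k <= l -> pbound k n <= pbound l n.
Proof. by move=> h; rewrite leq_pexp2l // addn2. Qed.

Lemma polyb_c c : polyb (fun=> c).
Proof.
exists c => n; apply: (@leq_trans (2 ^ c)); first exact/ltnW/ltn_expl.
exact: (@leq_pbound c 0 n).
Qed.

Lemma polyb_id : polyb (fun n => n).
Proof. by exists 1 => n; rewrite /pbound expn1 leq_addr. Qed.

Lemma polyb_pbound k : polyb (pbound k).
Proof. by exists k. Qed.

Lemma polyb_D f g : polyb f -> polyb g -> polyb (fun n => f n + g n).
Proof.
move=> [k hf] [l hg]; exists (maxn k l).+1 => n.
rewrite /pbound expnS -/(pbound _ _).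
have := hf n; have := hg n.
have := leq_pboundl n (leq_maxl k l); have := leq_pboundl n (leq_maxr k l).
rewrite mulnDl; nia.
Qed.

Lemma polyb_M f g : polyb f -> polyb g -> polyb (fun n => f n * g n).
Proof.
by move=> [k hf] [l hg]; exists (k + l) => n; rewrite /pbound expnD leq_mul.
Qed.

Lemma polyb_comp f g : polyb f -> polyb g -> polyb (fun n => f (g n)).
Proof.
move=> [k hf] [l hg]; exists ((l + 2) * k) => n.
apply: leq_trans (hf _) _.
rewrite /pbound expnM -/(pbound _ _); case: k {hf} => // k; rewrite leq_exp2r //.
have := hg n; have := pbound_gt0 l n.
rewrite /pbound expnD -/(pbound l n); nia.
Qed.

Lemma polyb_S f : polyb f -> polyb (fun n => (f n).+1).
Proof. by move=> h; have [k hk] := polyb_D (polyb_c 1) h; exists k. Qed.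

Lemma polyb_pboundf k f : polyb f -> polyb (fun n => pbound k (f n)).
Proof. exact/polyb_comp/polyb_pbound. Qed.

Ltac polyb := lazymatch goal with
  | |- polyb (fun _ => ?c) => exact: polyb_c
  | |- polyb (fun n => n) => exact: polyb_id
  | |- polyb (pbound _) => exact: polyb_pbound
  | |- polyb (fun n => @?f n + @?g n) => apply: (@polyb_D f g); polyb
  | |- polyb (fun n => @?f n * @?g n) => apply: (@polyb_M f g); polyb
  | |- polyb (fun n => (@?f n).+1) => apply: (@polyb_S f); polyb
  | |- polyb (fun n => pbound _ (@?f n)) => apply: (@polyb_pboundf _ f); polyb
  | |- _ => idtac
  end.

(** * Binary trees as codes for data *)

Inductive btree := Leaf | Node of btree & btree.

(** Preorder code. It is self-delimiting, so the components of a pair are concatenated without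
    separators. *)
Fixpoint tree_bits (d : btree) : seq bool :=
  if d is Node a b then true :: tree_bits a ++ tree_bits b else [:: false].

Lemma tree_bits_prefix a b r r' : tree_bits a ++ r = tree_bits b ++ r' -> a = b /\ r = r'.
Proof.
elim: a b r r' => [|a IHa a' IHa'] [|b b'] r r' //=; first by case.
by case; rewrite -!catA => /IHa [<-] /IHa' [<- <-].
Qed.

Lemma tree_bits_inj : injective tree_bits.
Proof. by move=> a b h; have [] := @tree_bits_prefix a b [::] [::]; rewrite ?cats0. Qed.

Structure datType := Dat { sort :> Type; as_tree : sort -> btree }.

Canonical dat_D := @Dat btree id.
Canonical dat_bool := @Dat bool (fun b => if b then Node Leaf Leaf else Leaf).
(** Unary, with the same code as a list of leaves: sizes bound values, and a loop counted by a
    number becomes a fold over a list. *)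
Canonical dat_nat := @Dat nat (fun n => iter n (Node Leaf) Leaf).
Canonical dat_prod (X Y : datType) := @Dat (X * Y)%type (fun z => Node (as_tree z.1)
    (as_tree z.2)).
Canonical dat_seq (X : datType) := @Dat (seq X) (foldr (fun x => Node (as_tree x)) Leaf).

Definition sz (X : datType) (x : X) := size (tree_bits (as_tree x)).

Lemma sz_gt0 (X : datType) (x : X) : 0 < sz x.
Proof. by rewrite /sz; case: (as_tree x). Qed.

Section Pt.
Variable A : finType.
Notation G := (A + bool)%type.
Notation cmd := (cmd G).
Notation store := (store G).

Definition runs c (s : store) T s' := exists2 t, t <= T & run c s t s'.

Lemma runs_le c s T s1 T' s2 : runs c s T s1 -> T <= T' -> s1 = s2 -> runs c s T' s2.
Proof. by move=> [t h H] h' <-; exists t; first exact: leq_trans h'. Qed.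

Lemma runs_seq c d s T s1 T' s2 : runs c s T s1 -> runs d s1 T' s2 -> runs (Seq c d) s
    (T + T') s2.
Proof. by move=> [t h H] [t' h' H']; exists (t + t'); [lia | exact: run_seq H']. Qed.

Lemma runs_case i f s T s1 : runs (f (ohead (s i))) s T s1 -> runs (Case i f) s T.+1 s1.
Proof. by move=> [t h H]; exists t.+1; last exact: run_case. Qed.

Lemma runs_while0 i c s : s i = [::] -> runs (While i c) s 1 s.
Proof. by exists 1; last exact: run_while0. Qed.

Lemma runs_while1 i c s T s1 T' s2 : s i != [::] -> runs c s T s1 -> runs (While i c) s1 T' s2 ->
  runs (While i c) s (T + T').+1 s2.
Proof.
by move=> hi [t h H] [t' h' H']; exists (t + t').+1; [lia | exact: run_while1 H'].
Qed.

Lemma runs_skip s : runs (@Skip _) s 1 s.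
Proof. by exists 1; last exact: run_skip. Qed.

Lemma runs_push i a s : runs (Push i a) s 2 (upd s i (a :: s i)).
Proof. by exists 2; last exact: run_push. Qed.

Lemma runs_pop i s : runs (@Pop _ i) s 1 (upd s i (behead (s i))).
Proof. by exists 1; last exact: run_pop. Qed.

Definition drain i (f : G -> cmd) : cmd :=
  While i (Case i (fun o => if o is Some a then Seq (Pop _ i) (f a) else @Skip _)).

Lemma runs_drain i f s a w T s1 T' s2 : s i = a :: w ->
  runs (f a) (upd s i w) T s1 -> runs (drain i f) s1 T' s2 -> runs (drain i f) s (T + T' + 3) s2.
Proof.
move=> Es H H'; apply: runs_le (runs_while1 (T := (1 + T).+1) _ _ H') _ _ => //; last by lia.
  by rewrite Es.
by apply: runs_case; rewrite Es; apply: runs_seq H; apply: runs_le (runs_pop i s) _ _;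
    rewrite // Es.
Qed.

Definition mv i j := drain i (Push j).
Definition cp i j k := drain i (fun a => Seq (Push j a) (Push k a)).
Definition clr i := drain i (fun=> @Skip _).

Ltac upd_ext := apply: functional_extensionality => r; rewrite /upd;
  repeat case: eqP => //; intros; subst; try congruence.

Lemma runs_mv i j s : i != j ->
  runs (mv i j) s (5 * size (s i) + 1) (upd (upd s i [::]) j (catrev (s i) (s j))).
Proof.
move=> ij; have ij' := ij; move/eqP: ij => ij; move Ew: (s i) => w;
    elim: w s Ew => [|a w IH] s Ew.
  by apply: runs_le (runs_while0 _ _) _ _ => //; upd_ext.
apply: runs_le (runs_drain Ew (runs_push _ _ _) (IH _ _)) _ _.
- by rewrite /upd (negbTE ij') eqxx.
- by rewrite /=; lia.
- by upd_ext.
Qed.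

Lemma runs_cp i j k s : i != j -> i != k -> j != k ->
  runs (cp i j k) s (7 * size (s i) + 1)
    (upd (upd (upd s i [::]) j (catrev (s i) (s j))) k (catrev (s i) (s k))).
Proof.
move=> /eqP ij /eqP ik /eqP jk; move Ew: (s i) => w; elim: w s Ew => [|a w IH] s Ew.
  by apply: runs_le (runs_while0 _ _) _ _ => //; upd_ext.
apply: runs_le (runs_drain Ew (runs_seq (runs_push _ _ _) (runs_push _ _ _)) (IH _ _)) _ _.
- by rewrite /upd; do 3 (case: eqP => //; try congruence).
- by rewrite /=; lia.
- by upd_ext.
Qed.

Lemma runs_clr i s : runs (clr i) s (4 * size (s i) + 1) (upd s i [::]).
Proof.
move Ew: (s i) => w; elim: w s Ew => [|a w IH] s Ew.
  by apply: runs_le (runs_while0 _ _) _ _ => //; upd_ext.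
apply: runs_le (runs_drain Ew (runs_skip _) (IH _ _)) _ _.
- by rewrite /upd eqxx.
- by rewrite /=; lia.
- by upd_ext.
Qed.

(* The store whose registers from [b] on are [l], with those below [b] taken from [s]. *)
Definition frame (s : store) b (l : seq (seq G)) : store :=
  fun j => if j < b then s j else nth [::] l (j - b).

Lemma frame_get s b l i : frame s b l (b + i) = nth [::] l i.
Proof. by rewrite /frame ltnNge leq_addr addKn. Qed.

Lemma upd_frame s b l i w : upd (frame s b l) (b + i) w = frame s b (set_nth [::] l i w).
Proof.
apply: functional_extensionality => j; rewrite /upd /frame nth_set_nth /=.
case: ltnP => h; first by case: eqP => // ?; lia.
by have -> : (j == b + i) = (j - b == i) by lia.
Qed.

Lemma frame_pad s b l n : frame s b l = frame s b (l ++ nseq n [::]).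
Proof.
apply: functional_extensionality => j; rewrite /frame nth_cat nth_nseq.
by case: ltnP => // h; case: ltnP => // h'; rewrite nth_default ?if_same.
Qed.

Lemma frame_cons s b u l : frame s b (u :: l) = frame (frame s b [:: u]) b.+1 l.
Proof.
apply: functional_extensionality => j; rewrite /frame.
case: (ltngtP j b) => h.
- by rewrite ltnW.
- by rewrite ltnS leqNgt h /=; have -> : j - b = (j - b.+1).+1 by lia.
- by rewrite h ltnSn subnn.
Qed.

Lemma frame_push i a s b l : runs (Push (b + i) a) (frame s b l) 2
  (frame s b (set_nth [::] l i (a :: nth [::] l i))).
Proof. by apply: runs_le (runs_push _ _ _) _ _ => //; rewrite upd_frame frame_get. Qed.

Lemma frame_pop i s b l : runs (Pop _ (b + i)) (frame s b l) 1
  (frame s b (set_nth [::] l i (behead (nth [::] l i)))).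
Proof. by apply: runs_le (runs_pop _ _) _ _ => //; rewrite upd_frame frame_get. Qed.

Lemma frame_mv i j s b l : i != j ->
  runs (mv (b + i) (b + j)) (frame s b l) (5 * size (nth [::] l i) + 1)
  (frame s b (set_nth [::] (set_nth [::] l i [::]) j (catrev (nth [::] l i) (nth [::] l j)))).
Proof.
by move=> ij; apply: runs_le (runs_mv _ _) _ _; rewrite ?eqn_add2l // ?upd_frame ?frame_get.
Qed.

Lemma frame_cp i j k s b l : i != j -> i != k -> j != k ->
  runs (cp (b + i) (b + j) (b + k)) (frame s b l) (7 * size (nth [::] l i) + 1)
  (frame s b (set_nth [::] (set_nth [::] (set_nth [::] l i [::]) j
     (catrev (nth [::] l i) (nth [::] l j))) k (catrev (nth [::] l i) (nth [::] l k)))).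
Proof.
by move=> ij ik jk; apply: runs_le (runs_cp _ _ _ _) _ _;
    rewrite ?eqn_add2l // ?upd_frame ?frame_get.
Qed.

Lemma frame_clr i s b l : runs (clr (b + i)) (frame s b l) (4 * size (nth [::] l i) + 1)
  (frame s b (set_nth [::] l i [::])).
Proof. by apply: runs_le (runs_clr _ _) _ _; rewrite ?upd_frame ?frame_get. Qed.

Lemma frame_case i f s b l T s1 : runs (f (ohead (nth [::] l i))) (frame s b l) T s1 ->
  runs (Case (b + i) f) (frame s b l) T.+1 s1.
Proof. by move=> H; apply: runs_case; rewrite frame_get. Qed.

Definition bt (b : bool) : G := inr b.

Definition reg_of (X : datType) (x : X) : seq G := map bt (tree_bits (as_tree x)).

Lemma size_reg_of (X : datType) (x : X) : size (reg_of x) = sz x.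
Proof. exact: size_map. Qed.

(* [f] is computed in place in register [b]; the registers above [b], empty before and after,
   are scratch space.  As [b] is arbitrary, such programs nest without relocation. *)
Definition pt (X Y : datType) (f : X -> Y) := exists k, forall b,
  exists c, forall s x, runs c (frame s b [:: reg_of x]) (pbound k (sz x)) (frame s b [:: reg_of
      (f x)]).

(** Apart from what nested programs use, three scratch registers suffice for every basic
    construction; padding by empty registers makes them explicit. *)
Lemma pt_intro (X Y : datType) (f : X -> Y) g : polyb g ->
  (forall b, exists c, forall s x, runs c (frame s b [:: reg_of x; [::]; [::]; [::]])
     (g (sz x)) (frame s b [:: reg_of (f x); [::]; [::]; [::]])) -> pt f.
Proof.
move=> [k hk] h; exists k => b; have [c hc] := h b; exists c => s x.
by rewrite (frame_pad _ _ [:: reg_of x] 3) (frame_pad _ _ [:: reg_of (f x)] 3);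
    apply: runs_le (hc s x) _ _.
Qed.

Lemma frame_sub s b u v : frame s b [:: u; v; [::]; [::]] = frame (frame s b [:: u]) b.+1 [:: v].
Proof. by rewrite frame_cons -(frame_pad _ _ [:: v] 2). Qed.

(** With base [b.+1], register [b] lies below the frame and is therefore preserved. *)
Lemma pt_sub (X Y : datType) (f : X -> Y) : pt f -> exists k, forall b,
  exists c, forall s u x, runs c (frame s b [:: u; reg_of x; [::]; [::]]) (pbound k (sz x))
     (frame s b [:: u; reg_of (f x); [::]; [::]]).
Proof.
move=> [k h]; exists k => b; have [c hc] := h b.+1; exists c => s u x.
by rewrite !frame_sub.
Qed.

Lemma pt_top (X Y : datType) (f : X -> Y) : pt f -> exists k, forall b,
  exists c, forall s x, runs c (frame s b [:: reg_of x; [::]; [::]; [::]]) (pbound k (sz x))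
     (frame s b [:: reg_of (f x); [::]; [::]; [::]]).
Proof.
move=> [k h]; exists k => b; have [c hc] := h b; exists c => s x.
by rewrite -(frame_pad _ _ [:: reg_of x] 3) -(frame_pad _ _ [:: reg_of (f x)] 3).
Qed.

(** By [run_size], a polynomial clock leaves no time to write a longer output. *)
Lemma pt_size (X Y : datType) (f : X -> Y) : pt f ->
  exists k, forall x, sz (f x) <= pbound k (sz x).
Proof.
move=> [k h]; have [l hl] : polyb (fun n => n + pbound k n) by polyb.
exists l => x; have [c /(_ (fun=> [::]) x) [t ht /run_size]] := h 0.
by move/(_ 0); rewrite /frame /= !size_reg_of => ?; apply: leq_trans (hl _); lia.
Qed.

(** Programs see only codes, so functions that agree on codes share a program; this moves results
    between types with the same coding. *)
Lemma pt_cast (X Y X' Y' : datType)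
    (f : X -> Y) (f' : X' -> Y') (c : X' -> X) :
  (forall x, as_tree (c x) = as_tree x) -> (forall x, as_tree (f (c x)) = as_tree (f' x)) ->
  pt f -> pt f'.
Proof.
move=> hc hf [k h]; exists k => b; have [p hp] := h b; exists p => s x.
by have := hp s (c x); rewrite /reg_of /sz hc hf.
Qed.

Lemma pt_id (X : datType) : pt (fun x : X => x).
Proof. by exists 0 => b; exists (@Skip _) => s x; apply: runs_skip. Qed.

Lemma pt_comp (X Y Z : datType) (g : Y -> Z) (f : X -> Y) :
  pt g -> pt f -> pt (fun x => g (f x)).
Proof.
move=> hg hf; have [m hm] := pt_size hf.
move: hg hf => /pt_top[k hg] /pt_top[l hf].
apply: (@pt_intro _ _ _ (fun n => pbound l n + pbound k (pbound m n))) => [|b]; first by polyb.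
have [c hc] := hf b; have [d hd] := hg b; exists (Seq c d) => s x.
apply: runs_seq (hc s x) _; apply: runs_le (hd s _) _ _ => //; exact: leq_pbound.
Qed.

Definition pushw i (w : seq G) : cmd := foldr (fun a c => Seq c (Push i a)) (@Skip _) w.

Lemma runs_pushw i w s : runs (pushw i w) s (2 * size w + 1) (upd s i (w ++ s i)).
Proof.
elim: w => [|a w IH] /=.
  by apply: runs_le (runs_skip _) _ _ => //; upd_ext.
by apply: runs_le (runs_seq IH (runs_push _ _ _)) _ _; [lia | upd_ext].
Qed.

Lemma frame_pushw i w s b l : runs (pushw (b + i) w) (frame s b l) (2 * size w + 1)
  (frame s b (set_nth [::] l i (w ++ nth [::] l i))).
Proof. by apply: runs_le (runs_pushw _ _ _) _ _; rewrite ?upd_frame ?frame_get. Qed.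

Lemma pt_const (X Y : datType) (y : Y) : pt (fun x : X => y).
Proof.
apply: (@pt_intro _ _ _ (fun n => 4 * n + 2 * sz y + 2)) => [|b]; first by polyb.
exists (Seq (clr (b + 0)) (pushw (b + 0) (reg_of y))) => s x.
apply: runs_le (runs_seq (frame_clr _ _ _ _) (frame_pushw _ _ _ _ _)) _ _;
    last by rewrite /= cats0.
by rewrite /= !size_reg_of; lia.
Qed.

Definition dup b := Seq (mv (b + 0) (b + 2)) (cp (b + 2) (b + 0) (b + 1)).

Lemma frame_dup s b u : runs (dup b) (frame s b [:: u; [::]; [::]; [::]]) (12 * size u + 2)
  (frame s b [:: u; u; [::]; [::]]).
Proof.
apply: runs_le (runs_seq (frame_mv _ _ _ _) (frame_cp _ _ _ _ _ _)) _ _ => //=.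
  by rewrite !catrevE ?(size_cat, size_rev) /=; lia.
by rewrite !catrevE !cats0 revK.
Qed.

Definition swp b := Seq (mv (b + 1) (b + 2)) (Seq (mv (b + 0) (b + 3))
  (Seq (mv (b + 2) (b + 0)) (mv (b + 3) (b + 1)))).

Lemma frame_swp s b u v : runs (swp b) (frame s b [:: u; v; [::]; [::]])
  (10 * size u + 10 * size v + 4) (frame s b [:: v; u; [::]; [::]]).
Proof.
apply: runs_le (runs_seq (frame_mv _ _ _ _) (runs_seq (frame_mv _ _ _ _) (runs_seq
    (frame_mv _ _ _ _) (frame_mv _ _ _ _)))) _ _ => //=.
  by rewrite !catrevE ?(size_cat, size_rev) /=; lia.
by rewrite !catrevE !cats0 !revK.
Qed.

Definition join b := Seq (mv (b + 0) (b + 2)) (Seq (mv (b + 1) (b + 3))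
  (Seq (mv (b + 3) (b + 0)) (Seq (mv (b + 2) (b + 0)) (Push (b + 0) (bt true))))).

Lemma frame_join s b u v : runs (join b) (frame s b [:: u; v; [::]; [::]])
  (10 * size u + 10 * size v + 6) (frame s b [:: bt true :: u ++ v; [::]; [::]; [::]]).
Proof.
apply: runs_le (runs_seq (frame_mv _ _ _ _) (runs_seq (frame_mv _ _ _ _) (runs_seq
    (frame_mv _ _ _ _)
  (runs_seq (frame_mv _ _ _ _) (frame_push _ _ _ _ _))))) _ _ => //=.
  by rewrite !catrevE ?(size_cat, size_rev) /=; lia.
by rewrite !catrevE !cats0 !revK.
Qed.

Lemma reg_of_pair (X Y : datType) (x : X) (y : Y) :
  reg_of (x, y) = bt true :: reg_of x ++ reg_of y.
Proof. by rewrite /reg_of /= map_cat. Qed.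

Lemma sz_pair (X Y : datType) (x : X) (y : Y) :
  sz (x, y) = (sz x + sz y).+1.
Proof. by rewrite /sz /= size_cat. Qed.

Lemma pt_pair (X Y Z : datType) (f : X -> Y) (g : X -> Z) :
  pt f -> pt g -> pt (fun x => (f x, g x)).
Proof.
move=> hf hg; have [m hm] := pt_size hf; have [n hn] := pt_size hg.
move: hf hg => /pt_sub[k hf] /pt_sub[l hg].
apply: (@pt_intro _ _ _ (fun i => (12 * i + 2) + (pbound k i +
  ((10 * i + 10 * pbound m i + 4) + (pbound l i + (10 * pbound m i + 10 * pbound n i + 6))))))
  => [|b]; first by polyb.
have [c hc] := hf b; have [d hd] := hg b.
(* Both functions run in the second register: [f] on one copy of the argument and, after the swap,
   [g] on the other. *)
exists (Seq (dup b) (Seq c (Seq (swp b) (Seq d (join b))))) => s x.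
have h1 := hm x; have h2 := hn x.
apply: runs_le (runs_seq (frame_dup _ _ _) (runs_seq (hc _ _ _) (runs_seq (frame_swp _ _ _ _)
  (runs_seq (hd _ _ _) (frame_join _ _ _ _))))) _ _; last by rewrite reg_of_pair.
by rewrite !size_reg_of; lia.
Qed.

(** The first bit of a code tells a leaf from a node, so one symbol of [c x] selects the branch. In
    the node branch [g] receives [x] together with [c x], which gives access to head and tail when
    [c x] is a list. *)
Lemma pt_case_gen (X Z U Y : datType)
    (c : X -> Z) (f : X -> Y) (g : U -> Y) (h : X -> Y) :
  (forall x, as_tree (c x) = Leaf -> h x = f x) ->
  (forall x, as_tree (c x) <> Leaf ->
     exists2 u, as_tree u = Node (as_tree x) (as_tree (c x)) & h x = g u) ->
  pt c -> pt f -> pt g -> pt h.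
Proof.
move=> h0 h1 hc hf hg; have [m hm] := pt_size hc.
move: hc hf hg => /pt_sub[k hc] /pt_top[l hf] /pt_top [n hg].
apply: (@pt_intro _ _ _ (fun i => (12 * i + 2) + (pbound k i +
  (4 * pbound m i + pbound l i + (10 * i + 10 * pbound m i + 6) + pbound n
      (i + pbound m i).+1 + 1).+1)))
  => [|b]; first by polyb.
have [p hp] := hc b; have [q hq] := hf b; have [r hr] := hg b.
exists (Seq (dup b) (Seq p (Case (b + 1) (fun o => if o == Some (bt true)
  then Seq (join b) r else Seq (clr (b + 1)) q)))) => s x.
have hx := hm x.
rewrite -{1}size_reg_of; apply: runs_seq (frame_dup _ _ _) (runs_seq (hp _ _ _) _).
apply: frame_case => /=.
case Ec: (as_tree (c x)) => [|d1 d2].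
  rewrite (_ : reg_of (c x) = [:: bt false]); last by rewrite /reg_of Ec.
  rewrite h0 // (_ : (_ == _) = false) //.
  apply: runs_le (runs_seq (frame_clr 1 _ _ [:: reg_of x; [:: bt false]; [::];
      [::]]) (hq _ _)) _ _ => //=; lia.
have [|u hu ->] := h1 x; first by rewrite Ec.
rewrite (_ : _ == _); last by rewrite /reg_of Ec.
have Eu : reg_of u = bt true :: reg_of x ++ reg_of (c x) by rewrite /reg_of hu /= map_cat.
apply: runs_le (runs_seq (frame_join _ _ _ _) _) _ (erefl _); first by rewrite -Eu; apply: hr.
rewrite !size_reg_of.
have : pbound n (sz u) <= pbound n (sz x + pbound m (sz x)).+1.
  by apply: leq_pbound; rewrite -size_reg_of Eu /= size_cat !size_reg_of; lia.
by lia.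
Qed.

Lemma reg_of_Node (d1 d2 : btree) : reg_of (Node d1 d2) = bt true :: reg_of d1 ++ reg_of d2.
Proof. by rewrite /reg_of -map_cat. Qed.

Lemma sz_Node (d1 d2 : btree) : sz (Node d1 d2) = (sz d1 + sz d2).+1.
Proof. by rewrite /sz -size_cat. Qed.

(* Register [b + 1] counts in unary the trees still to be moved from [b] to [b + 2]. *)
Definition sloop b := While (b + 1) (Case (b + 0) (fun o => if o is Some a then
     Seq (Pop _ (b + 0)) (Seq (Push (b + 2) a)
       (if a == bt true then Push (b + 1) (bt true) else Pop _ (b + 1)))
     else Pop _ (b + 1))).

Definition split b :=
  Seq (Pop _ (b + 0)) (Seq (Push (b + 1) (bt true))
  (sloop b)).

(** Reading [true] replaces one pending tree by two, reading [false] completes one. Taking the rest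
    of the run as a hypothesis lets the induction hypotheses for the two subtrees be chained. *)
Lemma split_loop (d : btree) s b r k w T s' :
  runs (sloop b) (frame s b [:: r; nseq k (bt true); catrev (reg_of d) w; [::]]) T s' ->
  runs (sloop b) (frame s b [:: reg_of d ++ r; nseq k.+1 (bt true); w; [::]]) (T + 7 * sz d) s'.
Proof.
elim: d r k w T => [|d1 IH1 d2 IH2] r k w T H.
  apply: runs_le (runs_while1 (T := (1 + (2 + 1)).+1) _ _ H) _ (erefl _).
  - by rewrite frame_get.
  - apply: frame_case; apply: runs_seq (frame_pop _ _ _ _) (runs_seq (frame_push _ _ _ _ _) _).
    exact: frame_pop.
  - by rewrite /sz /=; lia.
rewrite reg_of_Node /= -catA.
apply: runs_le (runs_while1 (T := (1 + (2 + 2)).+1) _ _ _) _ (erefl _).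
- by rewrite frame_get.
- apply: frame_case; apply: runs_seq (frame_pop _ _ _ _) (runs_seq (frame_push _ _ _ _ _) _).
  exact: frame_push.
- apply: (IH1 (reg_of d2 ++ r) k.+1 (bt true :: w)); apply: (IH2 r k).
  move: H; rewrite reg_of_Node !catrevE rev_cons rev_cat cat_rcons -catA; exact.
- by rewrite sz_Node; lia.
Qed.

Lemma frame_split s b (d1 d2 : btree) :
  runs (split b) (frame s b [:: reg_of (Node d1 d2); [::]; [::]; [::]]) (7 * sz d1 + 4)
    (frame s b [:: reg_of d2; [::]; rev (reg_of d1); [::]]).
Proof.
apply: runs_le (runs_seq (frame_pop _ _ _ _) (runs_seq (frame_push _ _ _ _ _) _)) _
    (erefl _) => /=.
  rewrite map_cat; apply: (@split_loop d1 s b _ 0); apply: runs_while0; exact: frame_get.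
by lia.
Qed.

Definition dfst d := if d is Node a _ then a else Leaf.
Definition dsnd d := if d is Node _ b then b else Leaf.

Lemma pt_dfst : pt dfst.
Proof.
apply: (@pt_intro _ _ _ (fun i => ((7 * i + 4) + ((4 * i + 1) + (5 * i + 1))).+1)) => [|b].
  by polyb.
exists (Case (b + 0) (fun o => if o == Some (bt true) then
  Seq (split b) (Seq (clr (b + 0)) (mv (b + 2) (b + 0))) else @Skip _)) => s [|d1 d2].
  by apply: frame_case; apply: runs_le (runs_skip _) _ _.
apply: frame_case; apply: runs_le (runs_seq (frame_split _ _ _ _) (runs_seq (frame_clr _ _ _ _)
    (frame_mv _ _ _ _))) _ _ => //=.
  by rewrite size_rev !size_reg_of sz_Node; lia.
by rewrite catrevE revK cats0.
Qed.

Lemma pt_dsnd : pt dsnd.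
Proof.
apply: (@pt_intro _ _ _ (fun i => ((7 * i + 4) + (4 * i + 1)).+1)) => [|b].
  by polyb.
exists (Case (b + 0) (fun o => if o == Some (bt true) then
  Seq (split b) (clr (b + 2)) else @Skip _)) => s [|d1 d2].
  by apply: frame_case; apply: runs_le (runs_skip _) _ _.
apply: frame_case; apply: runs_le (runs_seq (frame_split _ _ _ _) (frame_clr _ _ _ _)) _ _ => //=.
by rewrite size_rev !size_reg_of sz_Node; lia.
Qed.

Lemma pt_fst (X Y Z : datType) (f : X -> Y * Z) :
  pt f -> pt (fun x => (f x).1).
Proof.
move=> h; apply: (@pt_comp _ _ _ fst) => //.
by apply: pt_cast pt_dfst => // z; reflexivity.
Qed.

Lemma pt_snd (X Y Z : datType) (f : X -> Y * Z) :
  pt f -> pt (fun x => (f x).2).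
Proof.
move=> h; apply: (@pt_comp _ _ _ snd) => //.
by apply: pt_cast pt_dsnd => // z; reflexivity.
Qed.

Lemma pt_if (X Y : datType) (c : X -> bool) (f g : X -> Y) :
  pt c -> pt f -> pt g -> pt (fun x => if c x then f x else g x).
Proof.
move=> hc hf hg; apply: (@pt_case_gen X bool (X * bool)%type Y c g (fun z => f z.1)) => //.
- by move=> x; case: (c x).
- by move=> x; case Ec: (c x) => // _; exists (x, true); rewrite /= ?Ec.
exact/pt_comp/pt_fst/pt_id.
Qed.

Lemma pt_case (X Y Z : datType) (l : X -> seq Z)
    (f : X -> Y) (g : X -> Z -> seq Z -> Y) :
  pt l -> pt f -> pt (fun z : X * (Z * seq Z) => g z.1 z.2.1 z.2.2) ->
  pt (fun x => if l x is a :: l' then g x a l' else f x).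
Proof.
move=> hl hf hg.
apply: (@pt_case_gen X (seq Z) (X * (Z * seq Z))%type Y l f _ _ _ _ hl hf hg).
- by move=> x; case: (l x).
- by move=> x; case: (l x) => // a l' _; exists (x, (a, l')).
Qed.

(** A copy of the code of [i x] is popped one symbol per round and serves as the loop counter. The
    bound on all iterates keeps each round polynomial, as growth could otherwise compound. *)
Lemma pt_iter (X S : datType) (i : X -> S) (f : S -> S) q :
  pt f -> pt i -> polyb q ->
  (forall x k, k <= sz (i x) -> sz (iter k f (i x)) <= q (sz x)) ->
  pt (fun x => iter (sz (i x)) f (i x)).
Proof.
move=> /pt_sub[k hf] /pt_top[l hi] hq hb.
apply: (@pt_intro _ _ _ (fun n => pbound l n + ((12 * q n + 2) +
  ((q n * (pbound k (q n) + 2) + 1) + (5 * q n + 1 + (5 * q n + 1)))))) => [|b].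
  by polyb.
have [c hc] := hf b; have [d hd] := hi b.
exists (Seq d (Seq (dup b) (Seq (While (b + 0) (Seq (Pop _ (b + 0)) c))
  (Seq (mv (b + 1) (b + 2)) (mv (b + 2) (b + 0)))))) => s x.
have loop m u y Q : size u = m -> (forall i, i <= m -> sz (iter i f y) <= Q) ->
  runs (While (b + 0) (Seq (Pop _ (b + 0)) c)) (frame s b [:: u; reg_of y; [::]; [::]])
    (m * (pbound k Q + 2) + 1) (frame s b [:: [::]; reg_of (iter m f y); [::]; [::]]).
  elim: m u y => [|m IH] [|a u] y //= hu hQ; first by apply: runs_while0; rewrite frame_get.
  apply: runs_le (runs_while1 (s1 := frame s b [:: u; reg_of (f y); [::]; [::]]) _
    (runs_seq (frame_pop 0 s b [:: a :: u; reg_of y; [::]; [::]]) (hc _ _ _)) (IH _ _ _ _)) _ _.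
  - by rewrite frame_get.
  - by case: hu.
  - by move=> j hj; rewrite -iterSr; apply: hQ.
  - have : pbound k (sz y) <= pbound k Q by apply/leq_pbound/(hQ 0).
    by rewrite mulSn; lia.
  - by rewrite -iterSr.
have h0 := hb x 0 isT; have h1 := hb x (sz (i x)) (leqnn _).
apply: runs_le (runs_seq (hd _ _) (runs_seq (frame_dup _ _ _) (runs_seq (loop (sz (i x)) _ _ (q
    (sz x)) _ _)
  (runs_seq (frame_mv _ _ _ _) (frame_mv _ _ _ _))))) _ _ => //=.
- exact: size_reg_of.
- by move=> j; apply: hb.
- have : sz (i x) * (pbound k (q (sz x)) + 2) <= q (sz x) * (pbound k (q (sz x)) + 2).
    by rewrite leq_mul2r h0 orbT.
  move: h0; rewrite /= !catrevE ?(size_cat, size_rev) /= !size_reg_of; lia.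
- by rewrite !catrevE !cats0 revK.
Qed.

(** Destructive comparison: a symbol of [u] either cancels the top of [v] or goes to the mismatch
    stack [m]. Starting from an empty [m], the words are equal exactly when both components end
    empty. *)
Fixpoint cmp (u v m : seq G) : seq G * seq G :=
  if u is a :: u' then
    if ohead v == Some a then cmp u' (behead v) m else cmp u' v (a :: m)
  else (v, m).

Lemma cmp_size u v m : size (cmp u v m).1 <= size v /\
  size (cmp u v m).2 <= size m + size u.
Proof.
elim: u v m => [|a u IH] v m /=; first by rewrite addn0.
case: ifP => _.
  have [] := IH (behead v) m; rewrite size_behead; lia.
by have [] := IH v (a :: m); rewrite /=; lia.
Qed.

Lemma cmp_eq u v m : cmp u v m = ([::], [::]) <-> u = v /\ m = [::].
Proof.
elim: u v m => [|a u IH] v m /=.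
  by split=> [[-> ->]|[<- ->]].
case: eqP => Ev.
  by case: v Ev => //= b v [->]; rewrite IH; split=> [[-> ->]|[[->] ->]].
by rewrite IH; split=> [[]//|[h]]; case: v h Ev => // b v [->].
Qed.

Definition cmpl b := drain (b + 0) (fun a => Case (b + 1) (fun o =>
  if o == Some a then Pop _ (b + 1) else Push (b + 2) a)).

Lemma frame_cmpl s b u v m : runs (cmpl b) (frame s b [:: u; v; m; [::]]) (6 * size u + 1)
  (frame s b [:: [::]; (cmp u v m).1; (cmp u v m).2; [::]]).
Proof.
elim: u v m => [|a u IH] v m /=; first by apply: runs_while0; rewrite frame_get.
pose s1 := frame s b (if ohead v == Some a then [:: u; behead v; m; [::]] else [:: u; v; a :: m;
    [::]]).
have E0 : frame s b [:: a :: u; v; m; [::]] (b + 0) = a :: u by exact: frame_get.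
apply: runs_le (runs_drain (T := 3) (s1 := s1) E0 _ (_ : runs _ _ (6 * size u + 1) _)) _
    (erefl _).
- rewrite upd_frame.
  apply: frame_case; rewrite /s1 /=; case: ifP => _; last exact: frame_push.
  by apply: runs_le (frame_pop _ _ _ _) _ _.
- by rewrite /s1; case: ifP => _; apply: IH.
- by lia.
Qed.

Lemma pt_eqD : pt (fun z : btree * btree => if tree_bits z.1 == tree_bits z.2 then true else
    false).
Proof.
apply: (@pt_intro _ _ _ (fun i => (7 * i + 4) + ((5 * i + 1) + ((6 * i + 1) +
   (2 * (4 * i) + 9))))) => [|b]; first by polyb.
pose no := Seq (clr (b + 1)) (Seq (clr (b + 2)) (pushw (b + 0) [:: bt false])).
exists (Seq (split b) (Seq (mv (b + 2) (b + 1)) (Seq (cmpl b)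
  (Case (b + 1) (fun o => if o is Some _ then no else Case (b + 2)
      (fun o => if o is Some _ then no
    else pushw (b + 0) (reg_of true))))))) => s [x y] /=.
have no_ok v m : runs no (frame s b [:: [::]; v; m; [::]]) (4 * size v + 4 * size m + 5)
    (frame s b [:: [:: bt false]; [::]; [::]; [::]]).
  apply: runs_le (runs_seq (frame_clr _ _ _ _) (runs_seq (frame_clr _ _ _ _)
      (frame_pushw _ _ _ _ _))) _ _ => //=; lia.
apply: runs_seq; first by apply: runs_le (frame_split s b x y) _ (erefl _); rewrite sz_pair; lia.
apply: runs_seq.
  by apply: runs_le (frame_mv _ _ _ _) _ (erefl _); rewrite //= size_rev size_reg_of sz_pair; lia.
rewrite /= catrevE revK cats0.
apply: runs_seq.
  by apply: runs_le (frame_cmpl _ _ _ _ _) _ (erefl _); rewrite size_reg_of sz_pair; lia.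
have [hv hm] := cmp_size (reg_of y) (reg_of x) [::].
have heq := cmp_eq (reg_of y) (reg_of x) [::].
have -> : tree_bits x == tree_bits y = (cmp (reg_of y) (reg_of x) [::] == ([::], [::])).
  apply/eqP/eqP => [h|/heq [h _]]; first by apply/heq; rewrite /reg_of /= h.
  by symmetry; apply: inj_map h => ? ? [].
move: hv hm; rewrite !size_reg_of /=; case: (cmp _ _ _) => [v m] /= {heq} hv hm.
apply: (runs_le (T := (4 * size v + 4 * size m + 8).+1)) => //; last first.
  by rewrite sz_pair; lia.
apply: frame_case => /=; case: v {hv} => [|a v] /=; last by apply: runs_le
    (no_ok _ _) _ _ => //=; lia.
apply: (runs_le (T := (4 * size m + 7).+1)) => //; last by lia.
apply: frame_case => /=; case: m {hm} => [|a m] /=; last by apply: runs_le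
    (no_ok _ _) _ _ => //=; lia.
apply: runs_le (frame_pushw 0 (reg_of true) s b [:: [::]; [::]; [::]; [::]]) _ _ => //=; lia.
Qed.

Lemma pt_eq (X Y : datType) (e : rel Y) (f g : X -> Y) :
  (forall x y, e x y = (tree_bits (as_tree x) == tree_bits (as_tree y))) ->
  pt f -> pt g -> pt (fun x => e (f x) (g x)).
Proof.
move=> he hf hg.
apply: (@pt_comp _ _ _ (fun z : Y * Y => e z.1 z.2) _ _ (pt_pair hf hg)).
apply: (pt_cast (c := fun z : Y * Y => (as_tree z.1, as_tree z.2))) pt_eqD => // z /=.
by rewrite he; case: eqP.
Qed.

End Pt.

Arguments mv {A} i j.

Lemma sz_nil (X : datType) : sz ([::] : seq X) = 1.
Proof. by []. Qed.

Lemma sz_cons (X : datType) (x : X) l : sz (x :: l) = (sz x + sz l).+1.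
Proof. by rewrite /sz /= size_cat. Qed.

Lemma sz_nat (n : nat) : sz n = n.*2.+1.
Proof. by elim: n => // n IH; rewrite doubleS -IH. Qed.

Lemma sz_bool (b : bool) : sz b <= 3.
Proof. by case: b. Qed.

Lemma size_sz (X : datType) (l : seq X) : size l <= sz l.
Proof. elim: l => // x l IH; rewrite sz_cons /=; lia. Qed.

Lemma sz_drop (X : datType) k (l : seq X) : sz (drop k l) <= sz l.
Proof. elim: l k => [|x l IH] [|k] //=; have := IH k; rewrite sz_cons; lia. Qed.

Lemma sz_map_le (X : datType) (U : Type) (f : U -> X) m l :
  (forall u, sz (f u) <= m) -> sz (map f l) <= size l * m.+1 + 1.
Proof.
move=> h; elim: l => [|u l IH] //=; rewrite sz_cons; have := h u.
by rewrite mulSn; lia.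
Qed.

(** * Folds, lists and arithmetic in polynomial time *)

Section Library.
Variable A : finType.
Notation pt := (pt A).

Lemma pt_ext (X Y : datType) (f g : X -> Y) : f =1 g -> pt f -> pt g.
Proof. by move=> e; apply: pt_cast => // x; rewrite e. Qed.

Lemma pt_foldl (X Y Z : datType) (l : X -> seq Z) (a0 : X -> Y)
    (g : X -> Y -> Z -> Y) q : polyb q ->
  (forall x k, sz (foldl (g x) (a0 x) (take k (l x))) <= q (sz x)) ->
  pt (fun z : X * (Y * Z) => g z.1 z.2.1 z.2.2) -> pt l -> pt a0 ->
  pt (fun x => foldl (g x) (a0 x) (l x)).
Proof.
move=> hq hb hg hl ha; have [m hm] := pt_size hl.
(* The state carries the parameter, the unread suffix and the accumulator. On an empty suffix the
   step is the identity, so iterating [sz (init x)] times, at least the length of the list, does no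
   harm. *)
pose step (z : X * (seq Z * Y)) : X * (seq Z * Y) :=
  if z.2.1 is a :: l' then (z.1, (l', g z.1 z.2.2 a)) else z.
pose init x : X * (seq Z * Y) := (x, (l x, a0 x)).
have ptstep : pt step.
  apply: (@pt_case A _ _ _ (fun z : X * (seq Z * Y) => z.2.1) (fun z => z)
    (fun z a l' => (z.1, (l', g z.1 z.2.2 a)))).
  - by apply/pt_fst/pt_snd/pt_id.
  - exact: pt_id.
  - apply: pt_pair; first by apply/pt_fst/pt_fst/pt_id.
    apply: pt_pair; first by apply/pt_snd/pt_snd/pt_id.
    apply: (@pt_comp A _ _ _ _ (fun z : (X * (seq Z * Y)) * (Z * seq Z) =>
      (z.1.1, (z.1.2.2, z.2.1))) hg).
    apply: pt_pair; first by apply/pt_fst/pt_fst/pt_id.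
    apply: pt_pair; first by apply/pt_snd/pt_snd/pt_fst/pt_id.
    by apply/pt_fst/pt_snd/pt_id.
have ptinit : pt init by exact: pt_pair (@pt_id A X) (pt_pair hl ha).
have stepE k x : iter k step (init x) =
    (x, (drop k (l x), foldl (g x) (a0 x) (take k (l x)))).
  rewrite /init; elim: k => [|k IH]; first by rewrite drop0 take0.
  rewrite iterS IH /step /=; case E: (drop k (l x)) => [|a l'] /=.
    have hk : size (l x) <= k by rewrite -subn_eq0 -size_drop E.
    by rewrite !take_oversize ?drop_oversize // ltnW.
  have hk : k < size (l x) by rewrite ltnNge; apply/negP => /drop_oversize; rewrite E.
  have Ea : nth a (l x) k = a by rewrite -[k]addn0 -nth_drop E.
  rewrite (take_nth a hk) foldl_rcons Ea; congr (_, (_, _)).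
  by have := drop_nth a hk; rewrite E => -[].
have [||] := @pt_iter A _ _ init step (fun n => (n + (pbound m n + q n).+1).+1) ptstep ptinit.
- by polyb.
- move=> x k _; rewrite stepE !sz_pair.
  have := hb x k; have := hm x; have := sz_drop k (l x); lia.
move=> k hk; apply: (pt_ext (f := fun x => (iter (sz (init x)) step (init x)).2.2)).
  move=> x; rewrite stepE /= take_oversize // (leq_trans (size_sz (l x))) //.
  by rewrite /init !sz_pair; lia.
by apply/pt_snd/pt_snd; exists k.
Qed.

Lemma sz_foldl_add (Y Z : datType) (g : Y -> Z -> Y) M B a l :
  (forall y z, sz z <= M -> sz (g y z) <= sz y + B) -> sz l <= M ->
  sz (foldl g a l) <= sz a + size l * B.
Proof.
move=> hg; elim: l a => [|z l IH] a /=; first by rewrite addn0.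
rewrite sz_cons => h; apply: leq_trans (IH _ _) _; first by lia.
by rewrite mulSn; have := hg a z; lia.
Qed.

Lemma sz_take (X : datType) k (l : seq X) : sz (take k l) <= sz l.
Proof.
by elim: l k => [|x l IH] [|k] //=; rewrite !sz_cons ?sz_nil //; have := IH k; lia.
Qed.

(** If every element enlarges the accumulator by an amount independent of its current value, the
    total growth is at most the length of the list times that amount. *)
Lemma pt_foldl_add (X Y Z : datType) (l : X -> seq Z) (a0 : X -> Y)
    (g : X -> Y -> Z -> Y) k :
  (forall x y z, sz (g x y z) <= sz y + pbound k (sz x + sz z)) ->
  pt (fun z : X * (Y * Z) => g z.1 z.2.1 z.2.2) -> pt l -> pt a0 ->
  pt (fun x => foldl (g x) (a0 x) (l x)).
Proof.
move=> hk hg hl ha; have [m hm] := pt_size hl; have [n hn] := pt_size ha.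
apply: (pt_foldl (q := fun i => pbound n i + pbound m i * pbound k (i + pbound m i))) => //.
  by polyb.
move=> x j; have h1 := hm x; have h2 := hn x; have h3 := sz_take j (l x).
apply: leq_trans (sz_foldl_add (M := pbound m (sz x)) (B := pbound k (sz x + pbound m
    (sz x))) _ _ _) _.
- move=> y z hz; apply: leq_trans (hk _ _ _) _.
  by rewrite leq_add2l leq_pbound // leq_add2l.
- by lia.
- by rewrite leq_add // leq_mul // (leq_trans (size_sz _)) // (leq_trans h3).
Qed.

Lemma pt_nil (X Y : datType) : pt (fun x : X => [::] : seq Y).
Proof. exact: pt_const. Qed.

Lemma pt_cons (X Y : datType) (a : X -> Y) l :
  pt a -> pt l -> pt (fun x => a x :: l x).
Proof.
by move=> ha hl; apply: pt_cast (pt_pair ha hl) => // x; reflexivity.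
Qed.

Lemma pt_succ (X : datType) (n : X -> nat) : pt n -> pt (fun x => (n x).+1).
Proof.
by move=> hn; apply: pt_cast (pt_pair (pt_const A X Leaf) hn) => // x; reflexivity.
Qed.

Lemma pt_units (X : datType) (n : X -> nat) :
  pt n -> pt (fun x => nseq (n x) Leaf).
Proof.
move=> hn; apply: pt_cast hn => [//|x] /=; rewrite /as_tree.
by elim: (n x) => //= m ->.
Qed.

Lemma pt_rev (X Y : datType) (l : X -> seq Y) : pt l -> pt (fun x => rev (l x)).
Proof.
move=> hl; apply: (pt_ext (f := fun x => foldl (fun y z => z :: y) [::] (l x))).
  by move=> x; rewrite /rev; elim: (l x) [::] => //=.
apply: (pt_foldl_add (k := 1) (g := fun x y z => z :: y)) => //.
- by move=> x y z; rewrite sz_cons /pbound; lia.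
- by apply: pt_cons; [apply/pt_snd/pt_snd/pt_id | apply/pt_fst/pt_snd/pt_id].
- exact: pt_nil.
Qed.

Lemma pt_catrev (X Y : datType) (l l' : X -> seq Y) :
  pt l -> pt l' -> pt (fun x => catrev (l x) (l' x)).
Proof.
move=> hl hl'; apply: (pt_ext (f := fun x => foldl (fun y z => z :: y) (l' x) (l x))).
  by move=> x; elim: (l x) (l' x) => //=.
apply: (pt_foldl_add (k := 1) (g := fun x y z => z :: y)) => //.
- by move=> x y z; rewrite sz_cons /pbound; lia.
- by apply: pt_cons; [apply/pt_snd/pt_snd/pt_id | apply/pt_fst/pt_snd/pt_id].
Qed.

Lemma pt_cat (X Y : datType) (l l' : X -> seq Y) :
  pt l -> pt l' -> pt (fun x => l x ++ l' x).
Proof.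
move=> hl hl'; apply: (pt_ext (f := fun x => catrev (rev (l x)) (l' x))).
  by move=> x; rewrite catrevE revK.
exact/pt_catrev/hl'/pt_rev.
Qed.

Lemma pt_map (X Y Z : datType) (f : X -> Y -> Z) (l : X -> seq Y) :
  pt (fun z : X * Y => f z.1 z.2) -> pt l -> pt (fun x => [seq f x y | y <- l x]).
Proof.
move=> hf hl.
apply: (pt_ext (f := fun x => rev (foldl (fun acc y => f x y :: acc) [::] (l x)))).
  move=> x; transitivity (rev (catrev (map (f x) (l x)) [::]));
      last by rewrite catrevE cats0 revK.
  by congr rev; elim: (l x) [::] => //=.
have [m hm] := pt_size hf.
have [k hk] : polyb (fun n => (pbound m n.+1).+1) by polyb.
apply/pt_rev/(pt_foldl_add (k := k) (g := fun x acc y => f x y :: acc)) => //.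
- move=> x y z; apply: leq_trans (leq_add (leqnn _) (hk _)).
  by rewrite sz_cons; have := hm (x, z); rewrite sz_pair /=; lia.
- apply: pt_cons; last by apply/pt_fst/pt_snd/pt_id.
  apply: (@pt_comp A _ _ _ _ (fun z : X * (seq Z * Y) => (z.1, z.2.2)) hf).
  by apply: pt_pair; [apply/pt_fst/pt_id | apply/pt_snd/pt_snd/pt_id].
- exact: pt_nil.
Qed.

Lemma pt_flatten (X Y : datType) (l : X -> seq (seq Y)) :
  pt l -> pt (fun x => flatten (l x)).
Proof.
move=> hl; apply: (pt_ext (f := fun x => rev (foldl (fun acc y => catrev y acc) [::] (l x)))).
  move=> x; transitivity (rev (catrev (flatten (l x)) [::])); last by rewrite catrevE cats0 revK.
  by congr rev; elim: (l x) [::] => //= y l' IH acc; rewrite IH !catrevE rev_cat catA.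
apply/pt_rev/(pt_foldl_add (k := 1) (g := fun x acc y => catrev y acc)) => //.
- move=> x y z; rewrite /pbound expn1.
  suff : sz (catrev z y) <= sz z + sz y by lia.
  by elim: z y => [|u z IH] y /=; [lia | have := IH (u :: y); rewrite !sz_cons; lia].
- by apply: pt_catrev; [apply/pt_snd/pt_snd/pt_id | apply/pt_fst/pt_snd/pt_id].
- exact: pt_nil.
Qed.

Lemma pt_andb (X : datType) (a b : X -> bool) : pt a -> pt b -> pt (fun x => a x && b x).
Proof. by move=> ha hb; apply: (pt_if ha hb (pt_const _ _ false)). Qed.

Lemma pt_negb (X : datType) (a : X -> bool) : pt a -> pt (fun x => ~~ a x).
Proof. by move=> ha; apply: (pt_if ha (pt_const _ _ false) (pt_const _ _ true)). Qed.

Lemma pt_all (X Y : datType) (p : X -> Y -> bool) (l : X -> seq Y) :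
  pt (fun z : X * Y => p z.1 z.2) -> pt l -> pt (fun x => all (p x) (l x)).
Proof.
move=> hp hl; apply: (pt_ext (f := fun x => foldl (fun b y => b && p x y) true (l x))).
  move=> x; transitivity (true && all (p x) (l x)) => //.
  by elim: (l x) true => [|y l' IH] b /=; rewrite ?andbT // IH andbA.
apply: (pt_foldl_add (k := 2) (g := fun x b y => b && p x y)) => //.
- move=> x y z; have := sz_bool (y && p x z); have := sz_gt0 x; rewrite /pbound.
  have := sz_gt0 z; nia.
- apply: pt_andb; first by apply/pt_fst/pt_snd/pt_id.
  apply: (@pt_comp A _ _ _ _ (fun z : X * (bool * Y) => (z.1, z.2.2)) hp).
  by apply: pt_pair; [apply/pt_fst/pt_id | apply/pt_snd/pt_snd/pt_id].
- exact: pt_const.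
Qed.

Lemma pt_has (X Y : datType) (p : X -> Y -> bool) (l : X -> seq Y) :
  pt (fun z : X * Y => p z.1 z.2) -> pt l -> pt (fun x => has (p x) (l x)).
Proof.
move=> hp hl; apply: (pt_ext (f := fun x => ~~ all (fun y => ~~ p x y) (l x))).
  by move=> x; rewrite -[RHS]negbK -all_predC.
exact/pt_negb/pt_all/hl/pt_negb.
Qed.

Lemma pt_addn (X : datType) (m n : X -> nat) : pt m -> pt n -> pt (fun x => m x + n x).
Proof.
move=> hm hn; apply: (pt_ext (f := fun x => foldl (fun y _ => y.+1) (m x) (nseq (n x) Leaf))).
  by move=> x; elim: (n x) (m x) => [|k IH] l /=; [rewrite addn0 | rewrite IH addSnnS].
apply: (pt_foldl_add (k := 1) (g := fun _ y _ => y.+1)) => //.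
- by move=> x y z; rewrite !sz_nat /pbound; lia.
- by apply/pt_succ/pt_fst/pt_snd/pt_id.
- exact: pt_units.
Qed.

Lemma pt_muln (X : datType) (m n : X -> nat) : pt m -> pt n -> pt (fun x => m x * n x).
Proof.
move=> hm hn; apply: (pt_ext (f := fun x => foldl (fun y _ => y + m x) 0 (nseq (n x) Leaf))).
  move=> x; rewrite -[RHS]add0n.
  by elim: (n x) 0 => [|k IH] l /=; [rewrite muln0 addn0 | rewrite IH mulnS addnA].
have [k hk] := pt_size hm; have [k' hk'] : polyb (fun n => 2 * pbound k n) by polyb.
apply: (pt_foldl_add (k := k') (g := fun x y _ => y + m x)) => //.
- move=> x y z; apply: leq_trans (leq_add (leqnn _) (hk' _)).
  by have := hk x; have := leq_pbound k (leq_addr (sz z) (sz x)); rewrite !sz_nat; lia.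
- apply: pt_addn; first by apply/pt_fst/pt_snd/pt_id.
  exact: (@pt_comp A _ _ _ _ (fun z : X * (nat * btree) => z.1) hm (pt_fst (pt_id _ _))).
- exact: pt_units.
- exact: pt_const.
Qed.

Lemma pt_length (X Y : datType) (l : X -> seq Y) : pt l -> pt (fun x => size (l x)).
Proof.
move=> hl; apply: (pt_ext (f := fun x => foldl (fun y _ => y.+1) 0 (l x))).
  move=> x; rewrite -[RHS]add0n.
  by elim: (l x) 0 => [|z k IH] n /=; [rewrite addn0 | rewrite IH addSnnS].
apply: (pt_foldl_add (k := 1) (g := fun _ y _ => y.+1)) => //.
- by move=> x y z; rewrite !sz_nat /pbound; lia.
- by apply/pt_succ/pt_fst/pt_snd/pt_id.
- exact: pt_const.
Qed.

Lemma pt_iota0 (X : datType) (n : X -> nat) : pt n -> pt (fun x => iota 0 (n x)).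
Proof.
move=> hn.
have E k : foldl (fun y _ => size y :: y) [::] (nseq k Leaf) = rev (iota 0 k).
  elim: k => // k IH.
  by rewrite -[k.+1]addn1 nseqD foldl_cat IH iotaD rev_cat /= size_rev size_iota.
apply: (pt_ext (f := fun x => rev (foldl (fun y _ => size y :: y) [::] (nseq (n x) Leaf)))).
  by move=> x; rewrite E revK.
have [k hk] := pt_size hn.
(* The growth of a step depends on the length of the accumulator, so the additive criterion does not
   apply and the partial results are bounded directly. *)
apply: pt_rev; apply: (pt_foldl (g := fun _ y _ => size y :: y)
    (q := fun i => pbound k i * (2 * pbound k i + 2) + 1)).
- by polyb.
- move=> x j; have [i hi ->] : exists2 i, i <= n x & take j (nseq (n x) Leaf) = nseq i Leaf.
    case: (leqP j (n x)) => h; last by exists (n x); rewrite ?take_oversize ?size_nseq // ltnW.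
    by exists j => //; rewrite -{1}(subnKC h) nseqD take_size_cat ?size_nseq.
  rewrite E; have h := hk x; rewrite sz_nat in h.
  suff : sz (rev (iota 0 i)) <= i * (2 * pbound k (sz x) + 2) + 1.
    by move/leq_trans; apply; rewrite leq_add2r leq_mul2r; apply/orP; right; lia.
  have : i <= n x by []. 
  elim: i {hi} => // i IH hi.
  rewrite -[i.+1]addn1 iotaD rev_cat /= sz_cons sz_nat add0n.
  by have := IH (ltnW hi); lia.
- apply: pt_cons; first apply: pt_length; by apply/pt_fst/pt_snd/pt_id.
- exact: pt_units.
- exact: pt_nil.
Qed.

Lemma pt_nseq (X Y : datType) (n : X -> nat) (a : X -> Y) :
  pt n -> pt a -> pt (fun x => nseq (n x) (a x)).
Proof.
move=> hn ha; apply: (pt_ext (f := fun x => [seq a x | _ <- nseq (n x) Leaf])).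
  by move=> x; elim: (n x) => //= k ->.
apply: (pt_map (f := fun x _ => a x)); last exact: pt_units.
exact: (@pt_comp A _ _ _ _ (fun z : X * btree => z.1) ha (pt_fst (pt_id _ _))).
Qed.

Lemma pt_nth (X Y : datType) (d : Y) (l : X -> seq Y) (n : X -> nat) :
  pt l -> pt n -> pt (fun x => nth d (l x) (n x)).
Proof.
move=> hl hn.
apply: (pt_ext (f := fun x => if foldl (fun y _ => behead y) (l x) (nseq (n x) Leaf)
   is a :: _ then a else d)).
  move=> x; transitivity (if drop (n x) (l x) is a :: _ then a else d).
    by elim: (n x) (l x) => [|k IH] [|a l'] //=; rewrite IH //; case: (k).
  by elim: (n x) (l x) => [|k IH] [|a l'] //=; exact: IH.
apply: (pt_case (g := fun x a _ => a)).
- apply: (pt_foldl_add (k := 0) (g := fun _ y _ => behead y)) => //.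
  + by move=> x [|a y] z; rewrite /= ?sz_cons; lia.
  + apply: (pt_ext (f := fun z : X * (seq Y * btree) => if z.2.1 is a :: l' then l' else [::])).
      by move=> [x [[|a y] z]].
    apply: (pt_case (g := fun x a l' => l')); first by apply/pt_fst/pt_snd/pt_id.
      exact: pt_nil.
    by apply/pt_snd/pt_snd/pt_id.
  + exact: pt_units.
- exact: pt_const.
- by apply/pt_fst/pt_snd/pt_id.
Qed.

Lemma pt_horner (X : datType) (p : {poly nat}) (n : X -> nat) :
  pt n -> pt (fun x => p.[n x]%R).
Proof.
move=> hn; elim/poly_ind: p => [|p c IH].
  by apply: (pt_ext (f := fun=> 0)) => [x|]; [rewrite horner0 | exact: pt_const].
apply: (pt_ext (f := fun x => p.[n x]%R * n x + c)); first by move=> x; rewrite hornerMXaddC.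
by apply: pt_addn (pt_const _ _ _); apply: pt_muln.
Qed.

Lemma pt_eqT (X Y : datType) (T : eqType) (c : Y -> T) (f g : X -> Y) :
  injective c -> injective (@as_tree Y) -> pt f -> pt g -> pt (fun x => c (f x) == c (g x)).
Proof.
move=> hc inj hf hg; apply: (pt_eq (e := fun a b => c a == c b)) => // x y.
by apply/eqP/eqP => [/hc ->//|/tree_bits_inj/inj ->].
Qed.

End Library.

Lemma as_tree_nat_inj : injective (@as_tree dat_nat).
Proof. by elim=> [|m IH] [|n] //= -[/IH ->]. Qed.

Lemma as_tree_bool_inj : injective (@as_tree dat_bool).
Proof. by case=> [] []. Qed.

Lemma as_tree_seq_inj (X : datType) : injective (@as_tree X) -> injective (@as_tree (dat_seq X)).
Proof. by move=> h; elim=> [|x s IH] [|y t] //= -[/h -> /IH ->]. Qed.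

(** * From the calculus to Turing machines *)

Section Interface.
Variable A : finType.
Notation G := (A + bool)%type.
Notation bt := (@bt A).
Notation reg := (@reg_of A _).
Notation frame0 := (frame (fun=> [::] : seq G) 0).

Section Load.
Variable wd : A -> seq G.

(** Turns a tape word into the code of a list: the [false] pushed first is the empty list, and each
    letter prepends its word. The initial move reverses the input, so the last letter is treated
    first. *)
Definition load : cmd G :=
  Seq (mv 0 1) (Seq (Push 0 (bt false))
    (drain 1 (fun a => if a is inl a0 then pushw 0 (wd a0) else @Skip _))).

Lemma runs_load K w : (forall a, size (wd a) <= K) ->
  runs load (frame0 [:: map inl w; [::]; [::]; [::]])
    (5 * size w + 1 + (2 + (size w * (2 * K + 4) + 1)))
    (frame0 [:: flatten (map wd w) ++ [:: bt false]; [::]; [::]; [::]]).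
Proof.
move=> hK.
have loop u x : runs (drain 1 (fun a => if a is inl a0 then pushw 0 (wd a0) else @Skip _))
    (frame0 [:: x; map inl u; [::]; [::]]) (size u * (2 * K + 4) + 1)
    (frame0 [:: flatten (map wd (rev u)) ++ x; [::]; [::]; [::]]).
  elim: u x => [|a u IH] x; first exact: runs_while0.
  have E0 : frame0 [:: x; map inl (a :: u); [::]; [::]] (0 + 1) = inl a :: map inl u by [].
  apply: runs_le (runs_drain E0 (_ : runs _ _ (2 * K + 1) _) (IH (wd a ++ x))) _ _.
  - rewrite upd_frame; apply: runs_le (frame_pushw 0 (wd a) _ 0 [:: x; map inl u; [::];
      [::]]) _ _ => //.
    by have := hK a; lia.
  - by rewrite /= mulSn; lia.
  - by rewrite rev_cons map_rcons flatten_rcons catA.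
have H1 := frame_mv (i := 0) (j := 1) (fun=> [::] : seq G) 0 [:: map inl w; [::]; [::]; [::]] isT.
have H2 := frame_push 0 (bt false) (fun=> [::] : seq G) 0 [:: [::]; map inl (rev w); [::]; [::]].
apply: runs_seq; first by apply: runs_le H1 _ (erefl _); rewrite /= size_map.
rewrite /= catrevE cats0 -map_rev; apply: runs_seq; first exact: H2.
by apply: runs_le (loop _ _) _ _; rewrite ?size_rev ?revK.
Qed.
End Load.

Lemma pt_load (Sg : finType) (Z Y : datType) (inp : Sg -> A) (code : Sg -> Z)
    (wd : A -> seq G) (f : seq Z -> Y) :
  (forall a, wd (inp a) = bt true :: reg (code a)) -> pt A f ->
  exists c k, forall w : seq Sg,
    runs c (frame0 [:: map inl (map inp w); [::]; [::]; [::]]) (pbound k (size w))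
      (frame0 [:: reg (f (map code w)); [::]; [::]; [::]]).
Proof.
move=> hwd /pt_top[l] /(_ 0) [c hc].
(* The alphabet is finite, so the codes of its letters have a common size bound. *)
pose K := \max_a size (wd a).
have hK a : size (wd a) <= K by exact: leq_bigmax.
have hcode a : sz (code a) <= K by rewrite -(size_reg_of A) (leq_trans _ (hK (inp a))) // hwd.
have [k hk] : polyb (fun n => (5 * n + 1 + (2 + (n * (2 * K + 4) + 1))) + pbound l
    (n * K.+1 + 1)).
  by polyb.
exists (Seq (load wd) c), k => w.
have HW : flatten (map wd (map inp w)) ++ [:: bt false] = reg (map code w).
  elim: w => //= a w IH.
  by rewrite hwd -catA IH /reg_of /= map_cat.
have H := runs_load (map inp w) hK; rewrite HW size_map in H.
apply: runs_le (runs_seq H (hc _ _)) (leq_trans _ (hk _)) _ => //.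
by rewrite leq_add2l leq_pbound // sz_map_le.
Qed.

Lemma frame0_init w : upd (fun=> [::] : seq G) 0 w = frame0 [:: w; [::]; [::]; [::]].
Proof.
apply: functional_extensionality => -[|[|[|[|j]]]] //=; rewrite /frame /= nth_default //.
Qed.

Lemma pbound_horner k n : (('X + 2%:P)^+k : {poly nat}).[n]%R = pbound k n.
Proof. by rewrite horner_exp hornerD hornerX hornerC. Qed.

Lemma ohead_true (b : bool) : (ohead (reg b) == Some (bt true)) = b.
Proof. by case: b. Qed.

Section Emit.
Variables (Sg : finType) (out : Sg -> A).

(** A unary numeral is decoded by walking along [l]: each pair [true], [false] on register 0 skips a
    letter, and a [false] in place of such a pair emits the current one. *)
Fixpoint dec (l : seq Sg) : cmd G :=
  if l is a :: l' then Case 0 (fun o => Seq (Pop _ 0)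
    (if o == Some (bt true) then Seq (Pop _ 0) (dec l') else Push 1 (inl (out a))))
  else @Skip _.

Lemma runs_dec l a r w : a \in l ->
  runs (dec l) (frame0 [:: reg (index a l) ++ r; w; [::]; [::]]) (3 * size l + 4)
    (frame0 [:: r; inl (out a) :: w; [::]; [::]]).
Proof.
elim: l => // b l IH; rewrite inE /= [b == a]eq_sym; case: eqP => /= [-> _|_ ha].
  apply: runs_le (frame_case (i := 0) (b := 0) (runs_seq (frame_pop 0 _ 0 [:: bt false :: r; w;
      [::]; [::]])
    (frame_push 1 _ _ 0 [:: r; w; [::]; [::]]))) _ _  => //; lia.
apply: runs_le (frame_case (i := 0) (b := 0)
  (runs_seq (frame_pop 0 _ 0 [:: [:: bt true, bt false & [seq bt i | i <- tree_bits (iter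
      (index a l) (Node Leaf) Leaf)] ++ r]; w; [::]; [::]])
  (runs_seq (frame_pop 0 _ 0 [:: bt false :: [seq bt i | i <- tree_bits (iter (index a l)
      (Node Leaf) Leaf)] ++ r; w; [::]; [::]]) (IH ha)))) _ _ => //.
by have : forall n, 1 + (1 + (3 * n + 4)) < 3 * n.+1 + 4 by lia.
Qed.

Definition emit : cmd G :=
  While 0 (Case 0 (fun o => Seq (Pop _ 0)
    (if o == Some (bt true) then dec (enum Sg) else @Skip _))).

Lemma runs_emit u w :
  runs emit (frame0 [:: reg [seq index a (enum Sg) | a <- u]; w; [::]; [::]])
    (size u * (3 * #|Sg| + 7) + 5) (frame0 [:: [::]; catrev [seq inl (out a) | a <- u] w; [::];
        [::]]).
Proof.
elim: u w => [|a u IH] w.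
  apply: runs_le (runs_while1 _ (frame_case (i := 0) (b := 0) (runs_seq
      (frame_pop 0 _ 0 [:: [:: bt false]; w; [::]; [::]])
    (runs_skip _))) (runs_while0 _ _)) _ _ => //.
have E0 : reg [seq index a (enum Sg) | a <- a :: u] =
    bt true :: reg (index a (enum Sg)) ++ reg [seq index a (enum Sg) | a <- u].
  by rewrite /reg_of /= map_cat.
rewrite E0; set r := reg [seq _ | _ <- _] in IH *.
apply: runs_le (runs_while1 _ (frame_case (i := 0) (b := 0)
  (runs_seq (frame_pop 0 _ 0 [:: bt true :: reg (index a (enum Sg)) ++ r; w; [::]; [::]])
    (runs_dec _ _ _))) (IH _)) _ _ => //; first by rewrite mem_enum.
by rewrite /= -cardE mulSn; lia.
Qed.
End Emit.
End Interface.

Theorem pt_in_P (Sg : finType) (Z : datType) (code : Sg -> Z) (f : seq Z -> bool) :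
  pt Sg f -> in_P (fun w => f (map code w)).
Proof.
move=> hf.
have [c [k hc]] := @pt_load Sg Sg Z bool id code (fun a => bt _ true :: reg_of _ (code a)) f
  (fun _ => erefl) hf.
have [l hl] : polyb (fun n => (pbound k n).+1) by polyb.
pose M := machine (regs c) (inr true) c.
exists (Sg + bool)%type, inl, M, (('X + 2%:P)^+l)%R; split=> [x y []//|w].
rewrite pbound_horner; have [t ht H] := hc w.
have [|||ts [-> _]] := @machine_run (Sg + bool)%type (regs c) (inr true) c (map inl w) t
  (frame (fun=> [::]) 0 [:: reg_of Sg (f (map code w)); [::]; [::]; [::]]) (pbound l (size w)).
- exact: leqnSn.
- by rewrite frame0_init; move: H; rewrite map_id.
- exact: leq_ltn_trans ht (hl _).
by rewrite /halted /accepting /= inE inE /= ohead_true.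
Qed.

Theorem pt_polytime (S1 S2 : finType) (Z : datType) (code : S1 -> Z)
    (f : seq Z -> seq nat) (g : seq S1 -> seq S2) :
  (forall w, [seq index a (enum S2) | a <- g w] = f (map code w)) ->
  pt (S1 + S2)%type f -> polytime_computable g.
Proof.
move=> hg hf; pose A : finType := (S1 + S2)%type.
have [c [k hc]] := @pt_load A S1 Z (seq nat) inl code
  (fun a => if a is inl a0 then bt _ true :: reg_of _ (code a0) else [::]) f (fun _ => erefl) hf.
have [m hm] := pt_size hf.
pose K := \max_a sz (code a).
have [l hl] : polyb (fun n => (pbound k n + ((pbound m (n * K.+1 + 1) * (3 * #|S2| + 7) + 5)
  + (5 * pbound m (n * K.+1 + 1) + 1))).+1) by polyb.
pose e : cmd (A + bool)%type := emit (Sg := S2) inr.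
(* The output belongs on the last tape, so its index lies beyond all registers in use. [emit] leaves
   the word reversed in register 1, and moving it to tape [n] restores the order. *)
pose n := regs c + regs e + 2.
pose prog := Seq c (Seq e (mv 1 n)).
pose M := machine n (inr true) prog.
exists (A + bool)%type, (inl \o inl), (inl \o inr), M, (('X + 2%:P)^+l)%R.
split=> [x y []//|x y []//|w]; rewrite pbound_horner.
pose s1 : store (A + bool)%type := frame (fun=> [::]) 0 [:: [::];
    catrev [seq inl (inr a) | a <- g w] [::]; [::]; [::]].
have hgm : size (g w) <= pbound m (size w * K.+1 + 1).
  have := hm (map code w); rewrite -hg => h.
  apply: leq_trans (leq_trans h _).
    by rewrite -[X in X <= _](size_map (fun a => index a (enum S2))) size_sz.
  by rewrite leq_pbound // sz_map_le // => a; apply: leq_bigmax.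
have [t ht H] : runs prog (frame (fun=> [::]) 0 [:: map inl (map inl w); [::]; [::];
    [::]]) (pbound l (size w)).-1
    (upd (upd s1 1 [::]) n (catrev (s1 1) (s1 n))).
  apply: runs_le (runs_seq (hc w) (runs_seq _ (runs_mv _ _))) _ (erefl _).
  - by rewrite -hg; apply: runs_emit.
  - by rewrite /n; lia.
  - rewrite -ltnS prednK ?pbound_gt0 //; apply: leq_trans (hl _); rewrite ltnS leq_add2l.
    apply: leq_add; first by rewrite leq_add2r leq_mul2r hgm orbT.
    by rewrite /s1 /frame /= catrevE cats0 size_rev size_map leq_add2r leq_mul2l hgm orbT.
have [|||ts [-> Hts]] := @machine_run (A + bool)%type n (inr true) prog (map (inl \o inl) w) t
  (upd (upd s1 1 [::]) n (catrev (s1 1) (s1 n))) (pbound l (size w)).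
- have h : regs (mv 1 n : cmd (A + bool)%type) <= n.+1.
    rewrite /= !geq_max !ltnS.
    have -> : 1 <= n by rewrite /n; lia.
    by apply/bigmax_leqP => -[a|] _ //=; rewrite /n; lia.
  change (maxn (regs c) (maxn (regs e) (regs (mv 1 n : cmd (A + bool)%type))) <= n.+1).
  by rewrite 2!geq_max h /n; lia.
- by rewrite frame0_init map_comp.
- by apply: leq_ltn_trans ht _; rewrite prednK // pbound_gt0.
rewrite /halted /= inE; split=> //.
rewrite (rep_word (Hts ord_max)) /upd /= eqxx.
have -> : s1 n = [::].
  by rewrite /s1 -[n]add0n frame_get /n addn2; case: (_ + _) => [|[|?]] /=; rewrite ?nth_nil.
by rewrite /s1 /frame /= !catrevE !cats0 revK.
Qed.

(** Extension point of [pt_auto], rebound as further functions are shown polynomial. *)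
Ltac pt_user := fail.
Ltac pt_auto := cbv beta; lazymatch goal with
  | |- pt _ (fun x => x) => exact: pt_id
  | |- pt _ (fun _ => ?c) => exact: pt_const
  | |- pt _ (@fst _ _) => exact/pt_fst/pt_id
  | |- pt _ (@snd _ _) => exact/pt_snd/pt_id
  | |- pt _ (fun x => (@?f x, @?g x)) => apply: (pt_pair (f := f) (g := g)); pt_auto
  | |- pt _ (fun x => (@?f x).1) => apply: (pt_fst (f := f)); pt_auto
  | |- pt _ (fun x => (@?f x).2) => apply: (pt_snd (f := f)); pt_auto
  | |- pt _ (fun x => @?f x :: @?g x) => apply: (pt_cons (a := f) (l := g)); pt_auto
  | |- pt _ (fun x => @?f x ++ @?g x) => apply: (pt_cat (l := f) (l' := g)); pt_auto
  | |- pt _ (fun x => rev (@?f x)) => apply: (pt_rev (l := f)); pt_auto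
  | |- pt _ (fun x => flatten (@?f x)) => apply: (pt_flatten (l := f)); pt_auto
  | |- pt _ (fun x => map (@?f x) (@?g x)) => apply: (pt_map (f := f) (l := g)); pt_auto
  | |- pt _ (fun x => all (@?f x) (@?g x)) => apply: (pt_all (p := f) (l := g)); pt_auto
  | |- pt _ (fun x => has (@?f x) (@?g x)) => apply: (pt_has (p := f) (l := g)); pt_auto
  | |- pt _ (fun x => @?f x && @?g x) => apply: (pt_andb (a := f) (b := g)); pt_auto
  | |- pt _ (fun x => ~~ (@?f x)) => apply: (pt_negb (a := f)); pt_auto
  | |- pt _ (fun x => (@?f x).+1) => apply: (pt_succ (n := f)); pt_auto
  | |- pt _ (fun x => @?f x + @?g x) => apply: (pt_addn (m := f) (n := g)); pt_auto
  | |- pt _ (fun x => @?f x * @?g x) => apply: (pt_muln (m := f) (n := g)); pt_auto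
  | |- pt _ (fun x => size (@?f x)) => apply: (pt_length (l := f)); pt_auto
  | |- pt _ (fun x => iota 0 (@?f x)) => apply: (pt_iota0 (n := f)); pt_auto
  | |- pt _ (fun x => nseq (@?f x) (@?g x)) => apply: (pt_nseq (n := f) (a := g)); pt_auto
  | |- pt _ (fun x => nth ?d (@?f x) (@?g x)) => apply: (pt_nth (l := f) (n := g) d); pt_auto
  | |- pt _ (fun x => horner ?p (@?g x)) => apply: (pt_horner (n := g) p); pt_auto
  | |- pt _ (fun x => dfst (@?f x)) => apply: (@pt_comp _ _ _ _ dfst f);
      [exact: pt_dfst | pt_auto]
  | |- pt _ (fun x => dsnd (@?f x)) => apply: (@pt_comp _ _ _ _ dsnd f);
      [exact: pt_dsnd | pt_auto]
  | |- _ => first [apply: pt_if; pt_auto | pt_user]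
  end.

(** * Membership in NP *)

Notation family := (seq (seq (seq bool) * bool)).

(** Overlap computed on listings, built from combinators that [pt_auto] recognises. *)
Definition ovl (s s' : seq (seq bool)) : bool :=
  has (fun x => has (eq_op x) s') s &&
  (~~ all (fun x => has (eq_op x) s') s && ~~ all (fun x => has (eq_op x) s) s').

Lemma has_eq (T : eqType) (x : T) s : has (eq_op x) s = (x \in s).
Proof. by elim: s => //= y s ->; rewrite inE. Qed.

Lemma ovlE s s' : ovl s s' = overlap [fset x in s]%fset [fset x in s']%fset.
Proof.
rewrite /ovl /overlap; congr [&& _, ~~ _ & ~~ _].
- apply/hasP/fset0Pn => [[x xs]|[x]].
    by rewrite has_eq => xs'; exists x; rewrite !inE xs xs'.
  by rewrite !inE => /andP[xs xs']; exists x; rewrite ?has_eq.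
- apply/allP/fsubsetP => h x; have := h x; rewrite ?inE has_eq //.
- apply/allP/fsubsetP => h x; have := h x; rewrite ?inE has_eq //.
Qed.

(** The listings determine the graph, so marked listings describe a whole instance. The symbols are
    parameters because programs compute the encoding on numeric codes. *)
Definition encode (T : Type) (b : bool -> T) (c h : T) (F : family) : seq T :=
  flatten [seq [seq b (ovl s.1 s'.1) | s' <- F] ++ [:: h] | s <- F] ++
  (flatten [seq flatten [seq map b x ++ [:: c] | x <- s.1] ++ [:: h] | s <- F] ++
  [seq b s.2 | s <- F]).

Lemma map_encode (T U : Type) (f : T -> U) b c h F :
  map f (encode b c h F) = encode (fun x => f (b x)) (f c) (f h) F.
Proof.
rewrite /encode !map_cat !map_flatten -!map_comp; congr (flatten _ ++ (flatten _ ++ _)).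
  by apply: eq_map => s /=; rewrite map_cat -map_comp.
apply: eq_map => s /=; rewrite map_cat map_flatten -map_comp; congr (flatten _ ++ _).
by apply: eq_map => x /=; rewrite map_cat -map_comp.
Qed.

Definition solves (X : seq (seq bool)) (F : family) : bool :=
  all (fun x => has (fun s => has (eq_op x) s.1) F) X &&
  all (fun s => ~~ (ovl X s.1 && ~~ s.2) && ~~ (~~ ovl X s.1 && s.2)) F.

Lemma solvesE X F : solves X F =
  all (fun x => has (fun s => x \in s.1) F) X && all (fun s => ovl X s.1 == s.2) F.
Proof.
congr andb; last by apply: eq_all => s; case: (ovl _ _); case: (s.2).
by apply: eq_all => x; apply: eq_has => s; rewrite has_eq.
Qed.

Definition family_of (I : oe_instance) : family :=
  [seq (oe_listing v, v \in oe_marked I) | v <- enum 'I_(oe_order I)].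

Lemma oe_encodeE I : oe_encode I = encode bit comma hash (family_of I).
Proof.
have e u v : oe_edge (o:=I) u v = ovl (oe_listing u) (oe_listing v).
  rewrite ovlE; apply/idP/idP; first by move/(oe_repr (o:=I)).
  by move=> h; apply/(oe_repr (o:=I)).
rewrite /oe_encode /encode /family_of; move: (enum 'I_(oe_order I)) => l.
rewrite -!map_comp; congr (flatten _ ++ (flatten _ ++ _)).
  by apply: eq_map => u /=; rewrite cats1 -map_comp; congr rcons; apply: eq_map => v /=;
      rewrite e.
apply: eq_map => u /=; rewrite cats1; congr (rcons (flatten _) _).
by apply: eq_map => x /=; rewrite cats1.
Qed.

(** Taking overlap itself as the edge relation makes any family a representation. *)
Lemma family_instance (F : family) : exists I, family_of I = F.
Proof.
pose t (v : 'I_(size F)) := tnth (in_tuple F) v.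
have sym : symmetric (fun u v => ovl (t u).1 (t v).1).
  by move=> u v; rewrite !ovlE /overlap fsetIC; congr andb; rewrite andbC.
have irr : irreflexive (fun u v => ovl (t u).1 (t v).1).
  by move=> u; rewrite ovlE /overlap fsubset_refl andbF.
have repr : overlap_representation (fun u v => ovl (t u).1 (t v).1)
    (fun v => [fset x in (t v).1]%fset).
  by move=> u v; rewrite ovlE.
exists (@OEInstance (size F) _ (fun v => (t v).1) [set v | (t v).2] sym irr repr).
rewrite /family_of /= -[RHS]/(tval (in_tuple F)) -[RHS]map_tnth_enum.
by apply: eq_map => v; rewrite inE -surjective_pairing.
Qed.

(** The solution is presented as a filtered list of the listed elements, which keeps the certificate
    linear in the input. *)
Lemma overlap_extension_inv w : overlap_extension w ->
  exists F X, [/\ w = encode bit comma hash F, solves X F &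
    exists a, X = [seq x <- flatten (map fst F) | a x]].
Proof.
move=> [I [-> [X [sX hX]]]].
pose X' := [seq x <- flatten (map fst (family_of I)) | x \in X].
exists (family_of I), X'; split; [exact: oe_encodeE | | by exists (mem X)].
have mF x : x \in flatten (map fst (family_of I)) ->
    has (fun s => x \in s.1) (family_of I).
  by case/flattenP => l /mapP [s sF ->] xs; apply/hasP; exists s.
have EX : [fset x in X']%fset = X.
  apply/fsetP => x; rewrite inE mem_filter; case: (boolP (x \in X)) => //= xX.
  move/fsubsetP: sX => /(_ x xX) /bigfcupP [v _ xv].
  apply/flattenP; exists (oe_listing v); last by rewrite /oe_set inE in xv.
  by rewrite -map_comp; apply/mapP; exists v; rewrite ?mem_enum.
rewrite solvesE; apply/andP; split.
  by apply/allP => x; rewrite mem_filter => /andP[_]; apply: mF.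
apply/allP => s /mapP [v _ ->] /=; rewrite ovlE EX.
by apply/eqP; apply/idP/idP => /hX.
Qed.

Lemma overlap_extension_encode F X :
  solves X F -> overlap_extension (encode bit comma hash F).
Proof.
have [I <-] := family_instance F; rewrite solvesE => /andP[/allP h1 /allP h2].
exists I; split; first by rewrite oe_encodeE.
exists [fset x in X]%fset; split.
  apply/fsubsetP => x; rewrite inE => /h1 /hasP [s /mapP [v _ ->] /= xv].
  by apply/bigfcupP; exists v; rewrite ?mem_enum // /oe_set inE.
move=> v; rewrite /oe_set -ovlE.
by move/eqP: (h2 _ (map_f _ (mem_enum 'I_(oe_order I) v))) => /= ->.
Qed.

Lemma pt_eq_nats A (X : datType) (f g : X -> seq nat) :
  pt A f -> pt A g -> pt A (fun x => f x == g x).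
Proof. by apply: (@pt_eqT A X (seq nat) (seq nat) id f g _) => //;
    exact/as_tree_seq_inj/as_tree_nat_inj. Qed.

Lemma pt_eq_bits A (X : datType) (f g : X -> seq bool) :
  pt A f -> pt A g -> pt A (fun x => f x == g x).
Proof. by apply: (@pt_eqT A X (seq bool) (seq bool) id f g _) => //;
    exact/as_tree_seq_inj/as_tree_bool_inj. Qed.

Ltac pt_user ::= first [apply: pt_eq_nats; pt_auto | apply: pt_eq_bits; pt_auto].

Lemma pt_ovl A (X : datType) (f g : X -> seq (seq bool)) :
  pt A f -> pt A g -> pt A (fun x => ovl (f x) (g x)).
Proof.
move=> hf hg; pose h (z : seq (seq bool) * seq (seq bool)) := ovl z.1 z.2.
apply: (pt_comp (g := h) _ (pt_pair hf hg)).
by rewrite /h /ovl; pt_auto.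
Qed.

Ltac pt_user ::= first
  [apply: pt_eq_nats; pt_auto | apply: pt_eq_bits; pt_auto | apply: pt_ovl; pt_auto].

Lemma pt_encode A (X : datType) (b0 b1 c h : nat) (F : X -> family) :
  pt A F -> pt A (fun x => encode (fun b : bool => if b then b1 else b0) c h (F x)).
Proof.
move=> hF; apply: (pt_comp (g := encode (fun b : bool => if b then b1 else b0) c h) _ hF).
by rewrite /encode; pt_auto.
Qed.

Lemma pt_solves A (X : datType) (S : X -> seq (seq bool)) (F : X -> family) :
  pt A S -> pt A F -> pt A (fun x => solves (S x) (F x)).
Proof.
move=> hS hF; apply: (pt_comp (g := fun z => solves z.1 z.2) _ (pt_pair hS hF)).
by rewrite /solves; pt_auto.
Qed.

(* Reading a prefix code from right to left, the trees already read form a stack. *)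
Definition pstep (st : seq btree) (b : bool) : seq btree :=
  if b then (if st is x :: st' then (if st' is y :: st'' then Node x y :: st'' else st) else st)
  else Leaf :: st.

Definition parse (y : seq bool) : seq btree := foldl pstep [::] (rev y).

Lemma parse_cat d y : parse (tree_bits d ++ y) = d :: parse y.
Proof.
elim: d y => [|d1 IH1 d2 IH2] y; first by rewrite /parse rev_cons -cats1 foldl_cat.
by rewrite /= -catA /parse rev_cons -cats1 foldl_cat -/(parse _) IH1 IH2.
Qed.

Lemma pt_parse A (X : datType) (y : X -> seq bool) : pt A y -> pt A (fun x => parse (y x)).
Proof.
move=> hy; apply: (pt_foldl_add (k := 2) (g := fun _ => pstep)).
- move=> x st b; have h : 4 <= pbound 2 (sz x + sz b) by rewrite /pbound; nia.
  apply: leq_trans (leq_add (leqnn _) h).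
  case: b {h} => /=; last by rewrite sz_cons; have : sz Leaf = 1 by []; lia.
  case: st => [|a [|b st]]; rewrite ?sz_cons ?sz_Node; lia.
- rewrite /pstep; apply: pt_if; [pt_auto | | pt_auto].
  apply: (pt_case (g := fun z x st' => if st' is y :: st'' then Node x y :: st'' else z.2.1));
    [pt_auto | pt_auto |].
  apply: (pt_case (g := fun z y st'' => Node z.2.1 y :: st'')); [pt_auto | pt_auto |].
  apply: pt_cons; last by pt_auto.
  by apply: (pt_cast (f := fun z : _ => (z.1.2.1, z.2.1)) (c := id)) => //; pt_auto.
- exact: pt_rev.
- exact: pt_nil.
Qed.

(** * Decoding and verifying certificates *)

Fixpoint spine d : seq btree := if d is Node a b then a :: spine b else [::].
Definition is_node d := if d is Node _ _ then true else false.

Lemma pt_spine A (X : datType) (d : X -> btree) : pt A d -> pt A (fun x => spine (d x)).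
Proof.
move=> hd; apply: (pt_cast (f := d) (c := id)) => // x.
by elim: (d x) => //= a _ b {1}->.
Qed.

Lemma pt_is_node A (X : datType) (d : X -> btree) : pt A d -> pt A (fun x => is_node (d x)).
Proof.
move=> hd; apply: (pt_ext (f := fun x => if spine (d x) is _ :: _ then true else false)).
  by move=> x; case: (d x).
apply: (pt_case (g := fun _ _ _ => true)); [exact: pt_spine | pt_auto | pt_auto].
Qed.

Ltac pt_user ::= first
  [ apply: pt_eq_nats; pt_auto | apply: pt_eq_bits; pt_auto | apply: pt_ovl; pt_auto
  | apply: pt_spine; pt_auto | apply: pt_is_node; pt_auto | apply: pt_parse; pt_auto
  | apply: pt_encode; pt_auto | apply: pt_solves; pt_auto].

(** Decoding is total: a malformed certificate still denotes some family and set, so no check of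
    well-formedness is made. *)
Definition get_listing d := [seq [seq is_node b | b <- spine x] | x <- spine d].
Definition get_family d := [seq (get_listing (dfst z), is_node (dsnd z)) | z <- spine d].

Lemma spine_seq (X : datType) (s : seq X) : spine (as_tree s) = map (@as_tree X) s.
Proof. by elim: s => //= x s ->. Qed.

Lemma get_listingK (s : seq (seq bool)) : get_listing (as_tree s) = s.
Proof.
rewrite /get_listing spine_seq -map_comp -[RHS]map_id; apply: eq_map => x /=.
by rewrite spine_seq -map_comp -[RHS]map_id; apply: eq_map => -[].
Qed.

Lemma get_familyK (F : family) : get_family (as_tree F) = F.
Proof.
rewrite /get_family spine_seq -map_comp -[RHS]map_id; apply: eq_map => -[s b] /=.
by rewrite get_listingK; case: b.
Qed.

Definition code (a : oe_symbol) : nat := index a (enum oe_symbol).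

Lemma code_inj : injective code.
Proof. by move=> a b h; rewrite -(nth_index a (mem_enum _ a)) -/(code a) h nth_index // mem_enum.
    Qed.

Definition encode_nat := encode
  (fun b : bool => if b then code (bit true) else code (bit false)) (code comma) (code hash).

Lemma map_code_encode F : map code (encode bit comma hash F) = encode_nat F.
Proof.
rewrite map_encode /encode_nat; congr (encode _ _ _ _).
by apply: functional_extensionality => -[].
Qed.

Definition verifier_code (z : oe_symbol + bool) : bool * (nat * bool) :=
  match z with inl a => (true, (code a, false)) | inr b => (false, (0, b)) end.

Definition cert_family y := get_family (dfst (nth Leaf (parse y) 0)).
Definition cert_set y := get_listing (dsnd (nth Leaf (parse y) 0)).

(** Tags separate input from certificate. Comparison with the recomputed encoding ensures that the
    input encodes a genuine instance. *)
Definition verify (u : seq (bool * (nat * bool))) : bool :=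
  let x := flatten [seq if z.1 then [:: z.2.1] else [::] | z <- u] in
  let y := flatten [seq if z.1 then [::] else [:: z.2.2] | z <- u] in
  (x == encode_nat (cert_family y)) && solves (cert_set y) (cert_family y).

Lemma pt_verify A : pt A verify.
Proof.
rewrite /verify /cert_family /cert_set /get_family /get_listing /encode_nat.
by pt_auto.
Qed.

Lemma verify_split (x : seq oe_symbol) y :
  verify (map verifier_code (map inl x ++ map inr y)) =
  (map code x == encode_nat (cert_family y)) && solves (cert_set y) (cert_family y).
Proof.
rewrite /verify.
set x' := flatten _; set y' := flatten _.
have -> : x' = map code x.
  rewrite /x' map_cat -!map_comp map_cat flatten_cat -!map_comp.
  rewrite (_ : flatten [seq _ | _ <- y] = [::]) ?cats0; last by elim: (y).
  by elim: (x) => //= a s ->.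
have -> // : y' = y.
rewrite /y' map_cat -!map_comp map_cat flatten_cat -!map_comp.
rewrite (_ : flatten [seq _ | _ <- x] = [::]); last by elim: (x).
by elim: (y) => //= a s ->.
Qed.

Lemma sz_bits (x : seq bool) : sz x <= 4 * size x + 1.
Proof. by elim: x => // b x IH; rewrite sz_cons /=; have := sz_bool b; lia. Qed.

Lemma sz_cat (X : datType) (s t : seq X) : sz (s ++ t) + 1 = sz s + sz t.
Proof. by elim: s => [|x s IH] /=; rewrite ?sz_nil ?sz_cons; lia. Qed.

Definition weight (s : seq (seq bool)) := size (flatten [seq map bit x ++ [:: comma] | x <- s]).

Lemma sz_listing s : sz s <= 4 * weight s + 1.
Proof.
elim: s => // x s; rewrite /weight sz_cons /= !size_cat size_map /=.
by have := sz_bits x; lia.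
Qed.

(** [wt] is the length of the listing part of the encoding. The family has size at most
    [6 * wt + 1], marks and list nodes included, and the filtered list at most [4 * wt + 1]; hence
    the factor 10. *)
Lemma sz_certificate (F : family) (a : pred (seq bool)) :
  let X := [seq x <- flatten (map fst F) | a x] in
  sz (F, X) <= 10 * size (encode bit comma hash F) + 3.
Proof.
pose wt := \sum_(s <- F) (weight s.1).+1.
pose len := size (encode bit comma hash F).
have h1 : sz F + 4 * wt <= 10 * len + 1.
  rewrite /len /encode !size_cat.
  suff : sz F <= 6 * wt + 1 /\ wt =
      size (flatten [seq flatten [seq map bit x ++ [:: comma] | x <- s.1] ++ [:: hash] | s <- F]).
    by move=> [h <-]; lia.
  rewrite /wt; elim: F {wt len} => [|[s b] F [IH1 IH2]]; first by rewrite big_nil.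
  rewrite big_cons sz_cons sz_pair /= size_cat -IH2; split.
    by have := sz_listing s; have := sz_bool b; lia.
  by rewrite size_cat -/(weight s) /=; lia.
have h2 : sz (flatten (map fst F)) <= 4 * wt + 1.
  rewrite /wt; elim: (F) => [|[s b] F' IH]; first by rewrite big_nil.
  rewrite big_cons /= -[X in X <= _](addnK 1) sz_cat; have := sz_listing s; lia.
have h3 s : sz (filter a s) <= sz s.
  by elim: s => //= x s IH; case: (a x); rewrite !sz_cons; lia.
have h4 := leq_trans (h3 (flatten (map fst F))) h2.
rewrite /= sz_pair -/len; apply: (@leq_trans (sz F + (4 * wt + 1)).+1).
  by rewrite ltnS leq_add2l.
by lia.
Qed.

Theorem overlap_extension_in_NP : in_NP overlap_extension.
Proof.
exists (fun w => verify (map verifier_code w)), (10%:P * 'X + 3%:P)%R; split.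
  exact/pt_in_P/pt_verify.
move=> x; rewrite hornerD hornerM !hornerC hornerX.
split=> [/overlap_extension_inv [F [X [-> hs [a EX]]]]|[y [_]]].
  exists (tree_bits (as_tree (F, X))); split; first by rewrite EX; apply: sz_certificate.
  have Ep : parse (tree_bits (as_tree (F, X))) = [:: as_tree (F, X)] by rewrite -[tree_bits
      _]cats0 parse_cat.
  by rewrite verify_split /cert_family /cert_set Ep /= get_familyK get_listingK map_code_encode
      eqxx.
rewrite verify_split => /andP[/eqP hx hs]; move: hx; rewrite -map_code_encode => /(inj_map
    code_inj) ->.
exact: overlap_extension_encode hs.
Qed.

(** * From satisfiability to overlap extension *)

Section EncodeInj.
Variables (T : eqType) (sep : T).

Lemma cat_sep_inj (b b' r r' : seq T) : sep \notin b -> sep \notin b' ->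
  b ++ sep :: r = b' ++ sep :: r' -> b = b' /\ r = r'.
Proof.
elim: b b' => [|x b IH] [|x' b'] //=.
- by move=> _ _ [->].
- by rewrite inE negb_or => _ /andP[/eqP h _] [/h].
- by rewrite inE negb_or => /andP[/eqP h _] _ [/esym/h].
rewrite !inE !negb_or => /andP[_ hb] /andP[_ hb'] [-> h].
by have [-> ->] := IH _ hb hb' h.
Qed.

(** The first separator ends the first block, so blocks peel off from the left until the
    separator-free remainder is reached. *)
Lemma terminated_inj (bs bs' : seq (seq T)) r r' :
  all (fun b => sep \notin b) bs -> all (fun b => sep \notin b) bs' ->
  sep \notin r -> sep \notin r' ->
  flatten [seq b ++ [:: sep] | b <- bs] ++ r = flatten [seq b ++ [:: sep] | b <- bs'] ++ r' ->
  bs = bs' /\ r = r'.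
Proof.
have ref_false b rest s : sep \notin s -> (b ++ [:: sep]) ++ rest <> s.
  by move=> /negP h e; apply: h; rewrite -e !mem_cat inE eqxx orbT.
elim: bs bs' => [|b bs IH] [|b' bs'] //= h1 h2 h3 h4.
- by rewrite -catA => e; case: (ref_false _ _ _ h3 (esym e)).
- by rewrite -catA => e; case: (ref_false _ _ _ h4 e).
case/andP: h1 h2 => hb hbs /andP[hb' hbs'].
rewrite -!catA => /(cat_sep_inj hb hb') [-> /IH] [] // -> ->.
by [].
Qed.
End EncodeInj.

Lemma map_bit_inj : injective (map bit).
Proof. by apply: inj_map => a b []. Qed.

(** Rows and listings are blocks ended by [hash], and the marks form the [hash]-free remainder. The
    number of marks is the number of sets, which tells where the rows stop. *)
Lemma encode_inj : injective (encode bit comma hash).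
Proof.
pose rows (F : family) := [seq [seq bit (ovl s.1 s'.1) | s' <- F] | s <- F].
pose lists (F : family) := [seq flatten [seq map bit x ++ [:: comma] | x <- s.1] | s <- F].
have E F : encode bit comma hash F =
    flatten [seq b ++ [:: hash] | b <- rows F ++ lists F] ++ [seq bit s.2 | s <- F].
  by rewrite /encode map_cat flatten_cat -catA -!map_comp.
have h1 F : all (fun b => hash \notin b) (rows F ++ lists F).
  rewrite all_cat; apply/andP; split; apply/allP => b /mapP [s _ ->].
    by apply/negP => /mapP [].
  by apply/negP => /flattenP [u /mapP [x _ ->]]; rewrite mem_cat inE orbF => /mapP [].
have h2 (F : family) : hash \notin [seq bit s.2 | s <- F] by apply/negP => /mapP [].
move=> F F'; rewrite !E => /(terminated_inj (h1 F) (h1 F') (h2 F) (h2 F')) [eb em].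
have {}em : map snd F = map snd F'.
  by apply: map_bit_inj; rewrite -!map_comp.
have es : size F = size F' by rewrite -(size_map snd) em size_map.
have el : lists F = lists F'.
  by move/eqP: eb; rewrite eqseq_cat ?size_map // => /andP[_ /eqP].
have inj (s s' : seq (seq bool)) : flatten [seq map bit x ++ [:: comma] | x <- s] =
    flatten [seq map bit x ++ [:: comma] | x <- s'] -> s = s'.
  have h (u : seq (seq bool)) : all (fun b => comma \notin b) (map (map bit) u).
    by apply/allP => b /mapP [x _ ->]; apply/negP => /mapP [].
  have := @terminated_inj _ comma (map (map bit) s) (map (map bit) s') [::] [::] (h s)
      (h s') isT isT.
  by rewrite !cats0 -!map_comp => H /H [/(inj_map map_bit_inj)].
have {}el : map fst F = map fst F'.
  by apply: (inj_map inj); rewrite -!map_comp.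
by rewrite -(zip_unzip F) -(zip_unzip F') /unzip1 /unzip2 el em.
Qed.

(** * Clauses as splitting constraints *)

Definition literal : Type := bool * seq nat.

Definition satisfies (al : seq nat -> bool) (phi : seq (seq literal)) : bool :=
  all (has (fun l => al l.2 == l.1)) phi.

(** The leading [true] keeps names of literals apart from the four auxiliary elements, which are
    empty or begin with [false]. *)
Definition name (l : literal) : seq bool :=
  true :: l.1 :: flatten [seq nseq n true ++ [:: false] | n <- l.2].

Lemma name_inj : injective name.
Proof.
move=> [b v] [b' v'] [<- h]; congr pair.
have inj : injective (fun n => nseq n true) by move=> m n /(congr1 size); rewrite !size_nseq.
have ref_false (u : seq nat) : all (fun b => false \notin b) [seq nseq n true | n <- u].
  by apply/allP => x /mapP [n _ ->]; rewrite mem_nseq andbF.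
have := @terminated_inj _ false _ _ [::] [::] (ref_false v) (ref_false v') isT isT.
by rewrite !cats0 -!map_comp => /(_ h) [/(inj_map inj)].
Qed.

Definition ref_false : seq bool := [::].
Definition ref_true : seq bool := [:: false].
Definition inside : seq bool := [:: false; false].
Definition outside : seq bool := [:: false; true].

Definition neg (l : literal) : literal := (~~ l.1, l.2).

(* Whichever value [X] assigns to [ref_false] counts as false.  The first two pairs are disjoint
   and both split by [X], which is therefore not contained in any of the other sets. *)
Definition family_cnf (phi : seq (seq literal)) : family :=
  [seq (s, true) | s <- [:: [:: ref_false; ref_true]; [:: inside; outside]] ++
    ([seq [:: name l; name (neg l)] | l <- flatten phi] ++
     [seq ref_false :: map name C | C <- phi])].

Lemma ovlP (X s : seq (seq bool)) : reflect
  [/\ exists2 x, x \in X & x \in s, exists2 x, x \in X & x \notin s &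
      exists2 x, x \in s & x \notin X] (ovl X s).
Proof.
rewrite /ovl; apply: (iffP and3P) => [[/hasP [x h1 h2] /allPn [y h3 h4] /allPn [z h5 h6]]|[[x h1
    h2] [y h3 h4] [z h5 h6]]].
  by split; [exists x | exists y | exists z]; rewrite // -has_eq.
by split; [apply/hasP; exists x | apply/allPn; exists y | apply/allPn; exists z]; rewrite ?has_eq.
Qed.

Lemma family_cnf_complete al phi : satisfies al phi -> exists X, solves X (family_cnf phi).
Proof.
move=> /allP sat.
pose true_lit (l : literal) := al l.2 == l.1.
(* [ref_false] and [outside] are left out. A clause set then meets [X] in a true literal, misses it
   at [ref_false], and [inside] witnesses that [X] is not contained in it. Only literals of [phi]
   and their negations are used, as [X] must stay within the listed elements. *)
exists ([:: ref_true; inside] ++ map name [seq l <- flatten phi ++ map neg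
    (flatten phi) | true_lit l]).
set X := _ ++ _.
have memN l : (name l \in X) = (l \in flatten phi ++ map neg (flatten phi)) && true_lit l.
  by rewrite mem_cat (mem_map name_inj) mem_filter andbC.
have yX : ref_true \in X by rewrite mem_cat inE.
have iX : inside \in X by rewrite mem_cat !inE eqxx orbT.
have nX : ref_false \notin X by rewrite mem_cat !inE /=; apply/negP => /mapP [].
have oX : outside \notin X by rewrite mem_cat !inE /=; apply/negP => /mapP [].
have in_F s : s \in [:: [:: ref_false; ref_true]; [:: inside; outside]] ++
    ([seq [:: name l; name (neg l)] | l <- flatten phi] ++
     [seq ref_false :: map name C | C <- phi]) -> (s, true) \in family_cnf phi by exact: map_f.
rewrite solvesE; apply/andP; split; apply/allP.
  move=> x; rewrite mem_cat !inE => /orP[/orP[]/eqP->|/mapP [l hl0 ->]]; apply/hasP.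
  - by exists ([:: ref_false; ref_true], true); [apply: in_F | rewrite !inE eqxx].
  - by exists ([:: inside; outside], true); [apply: in_F;
      rewrite !inE eqxx orbT | rewrite !inE eqxx].
  move: hl0; rewrite mem_filter mem_cat => /andP[_ /orP[hl|/mapP [l' hl ->]]].
    exists ([:: name l; name (neg l)], true); last by rewrite !inE eqxx.
    by apply: in_F; rewrite mem_cat; apply/orP; right; rewrite mem_cat map_f.
  exists ([:: name l'; name (neg l')], true); last by rewrite !inE eqxx orbT.
  by apply: in_F; rewrite mem_cat; apply/orP; right; rewrite mem_cat map_f.
move=> s /mapP [s' + ->] /=; rewrite eqb_id mem_cat !inE mem_cat => h; apply/ovlP.
move: h => /orP[/orP[]/eqP->|/orP[/mapP[l hl ->]|/mapP[C hC ->]]].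
- by split; [exists ref_true => // | exists inside => // | exists ref_false => //];
    rewrite !inE ?eqxx ?orbT.
- by split; [exists inside => // | exists ref_true => // | exists outside => //];
    rewrite !inE ?eqxx ?orbT.
- have h1 : (name l \in X) = true_lit l by rewrite memN mem_cat hl.
  have h2 : (name (neg l) \in X) = ~~ true_lit l.
    rewrite memN mem_cat map_f ?orbT // /true_lit /=.
    by case: (al _); case: (l.1).
  split; last 2 first.
  + by exists inside; rewrite // !inE.
  + case ht: (true_lit l); [exists (name (neg l)) | exists (name l)];
      by rewrite ?h1 ?h2 ?ht ?inE ?eqxx ?orbT.
  case ht: (true_lit l); [exists (name l) | exists (name (neg l))];
    by rewrite ?h1 ?h2 ?ht ?inE ?eqxx ?orbT.
have /hasP [l lC tl] := sat C hC.
split.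
- exists (name l); last by rewrite inE map_f ?orbT.
  by rewrite memN /true_lit tl andbT mem_cat; apply/orP; left; apply/flattenP; exists C.
- by exists inside; rewrite // inE /=; apply/negP => /mapP [].
- by exists ref_false; rewrite ?inE.
Qed.

Lemma family_cnf_sound X phi : solves X (family_cnf phi) -> exists al, satisfies al phi.
Proof.
rewrite solvesE => /andP[_ /allP sol].
have ov s : s \in [:: [:: ref_false; ref_true]; [:: inside; outside]] ++
    ([seq [:: name l; name (neg l)] | l <- flatten phi] ++
     [seq ref_false :: map name C | C <- phi]) -> ovl X s.
  by move=> hs; have := sol _ (map_f (fun s => (s, true)) hs); rewrite eqb_id.
have pair l : l \in flatten phi -> (name (neg l) \in X) = ~~ (name l \in X).
  move=> hl; have /ovlP [[x xX xs] _ [y ys yX]] : ovl X [:: name l; name (neg l)].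
    by apply: ov; rewrite mem_cat; apply/orP; right; rewrite mem_cat map_f.
  move: xs ys; rewrite !inE => /orP[]/eqP ex /orP[]/eqP ey; rewrite {}ex in xX;
      rewrite {}ey in yX;
    by rewrite ?(negbTE yX) ?xX //; rewrite xX in yX.
(* The sum modulo 2 normalises the side of [X] on which [ref_false] lies to the value false. *)
pose al v := (name (true, v) \in X) (+) (ref_false \in X).
exists al; apply/allP => C hC.
have hl l : l \in C -> (al l.2 == l.1) = ((name l \in X) (+) (ref_false \in X)).
  move=> lC; have hl : l \in flatten phi by apply/flattenP; exists C.
  have := pair l hl; rewrite /al; case: l {lC hl} => [[] v] /=; rewrite /neg /=.
    by case: (_ (+) _).
  by move=> ->; case: (_ \in _); case: (_ \in _).
have /ovlP [[x xX xC] _ [y yC yX]] : ovl X (ref_false :: map name C).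
  by apply: ov; rewrite mem_cat; apply/orP; right; rewrite mem_cat map_f ?orbT.
(* A true literal lies on the opposite side from [ref_false]: it is the element missed by [X] if
   [ref_false] is in [X], and the element hit otherwise. *)
move: xC yC; rewrite !inE; case nX: (ref_false \in X).
  move=> _ /orP[/eqP ey|/mapP [l lC ey]]; first by rewrite ey nX in yX.
  by apply/hasP; exists l; rewrite // hl // -ey (negbTE yX) nX.
move=> /orP[/eqP ex|/mapP [l lC ex]] _; first by rewrite ex nX in xX.
by apply/hasP; exists l; rewrite // hl // -ex xX nX.
Qed.

Lemma family_cnf_correct phi :
  (exists al, satisfies al phi) <-> overlap_extension (encode bit comma hash (family_cnf phi)).
Proof.
split=> [[al /family_cnf_complete [X]]|/overlap_extension_inv [F [X [/encode_inj <- h _]]]].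
  exact: overlap_extension_encode.
exact: family_cnf_sound h.
Qed.

Lemma pt_family_cnf A : pt A (fun phi : seq (seq (bool * seq nat)) => family_cnf phi).
Proof. by rewrite /family_cnf /name /neg; pt_auto. Qed.

(** * The tableau formula *)

(* The content of cell [p] when cell [N.+1] is the scanned one. *)
Definition cell (G : Type) N (tp : tape G) p : option G :=
  if p <= N then nth None (tleft tp) (N - p) else nth None (tright tp) (p - N.+1).

(** A move carries the content of cell [k.+1] to cell [k + shift m]; measuring from [k] avoids
    negative offsets. *)
Definition shift (m : move) : nat :=
  match m with MoveLeft => 2 | Stay => 1 | MoveRight => 0 end.

Lemma cell_head (G : Type) N (tp : tape G) : cell N tp N.+1 = tape_read tp.
Proof. by rewrite /cell ltnn subnn. Qed.

Lemma cell_act (G : Type) N (tp : tape G) s m k :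
  cell N (tape_act tp (s, m)) (k + shift m) = if k == N then s else cell N tp k.+1.
Proof.
have nb (l : seq (option G)) i : nth None (behead l) i = nth None l i.+1 by rewrite nth_behead.
case: m => /=; rewrite /cell /=.
- case: eqP => [->|hk].
    have -> : (N + 2 <= N) = false by lia.
    by have -> : N + 2 - N.+1 = 1 by lia.
  case: (ltngtP k.+1 N) => h.
  + have -> : k + 2 <= N by lia.
    by rewrite nb; congr nth; lia.
  + have -> : (k + 2 <= N) = false by lia.
    have -> : k + 2 - N.+1 = (k - N.+1).+2 by lia.
    by rewrite /= nb; congr nth; lia.
  + have -> : (k + 2 <= N) = false by lia.
    have -> : k + 2 - N.+1 = 0 by lia.
    by rewrite -h subnn nth0.
- case: eqP => [->|hk].
    have -> : (N + 1 <= N) = false by lia.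
    by have -> : N + 1 - N.+1 = 0 by lia.
  rewrite addn1; case: leqP => h //.
  have -> : k.+1 - N.+1 = (k - N.+1).+1 by lia.
  by rewrite /= nb.
- case: eqP => [->|hk]; first by rewrite addn0 leqnn subnn.
  rewrite addn0; case: (ltngtP k N) => h //.
    by have -> : N - k = (N - k.+1).+1 by lia.
  by rewrite nb; congr nth; lia.
Qed.

Lemma nth_map_default (T1 T2 : Type) (f : T1 -> T2) d s j :
  nth (f d) (map f s) j = f (nth d s j).
Proof. by elim: s j => [|x s IH] [|j] /=. Qed.

Section CookLevin.
Variables (Sg G : finType) (inp : Sg + bool -> G) (M : TM G).
Notation n := (tm_tapes M).
Notation reads := {ffun 'I_n.+1 -> option G}.

Definition state_code (q : tm_state M) : nat := index q (enum (tm_state M)).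
Definition symbol_code (a : option G) : nat := index a (enum {: option G}).

Lemma symbol_code_inj : injective symbol_code.
Proof. by move=> a b h; rewrite -(nth_index a (mem_enum _ a)) -/(symbol_code a) h nth_index //
    mem_enum. Qed.

(** An idle transition in halting states spares the clauses a halting case. *)
Definition next (q : tm_state M) (r : reads) :=
  if q \in @tm_halt _ M then (q, [ffun i => (r i, Stay)]) else tm_trans q r.

Definition scan (c : config M) : reads := [ffun i => tape_read (ctapes c i)].

Lemma step_state c : cstate (tm_step c) = (next (cstate c) (scan c)).1.
Proof. by rewrite /tm_step /next; case: ifP => // _; case: tm_trans. Qed.

Lemma step_cell N c i k (a := (next (cstate c) (scan c)).2 i) :
  cell N (ctapes (tm_step c) i) (k + shift a.2) =
  if k == N then a.1 else cell N (ctapes c i) k.+1.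
Proof.
rewrite /a /tm_step /next; case: ifP => _ /=; last first.
  by case: tm_trans => q act /=; case: (act i) => s m /=; rewrite cell_act.
by rewrite !ffunE /= addn1; case: eqP => // ->; rewrite cell_head.
Qed.

(* The literal with sign [b] of the variable "at time [t], cell [p] of tape [i] contains [a]";
   tape [n.+1] has the state in the cell of the head. *)
Definition lit (b : bool) (t i p a : nat) : bool * seq nat := (b, [:: t; i; p; a]).

(* A literal whose time and position are relative: (sign, (time offset, (tape,
   (relative to [k] rather than to the head, (position offset, content))))). *)
Definition template : Type := bool * (nat * (nat * (bool * (nat * nat)))).

Definition instance (N t k : nat) (l : template) : bool * seq nat :=
  (l.1, [:: t + l.2.1; l.2.2.1; (if l.2.2.2.1 then k else N) + l.2.2.2.2.1; l.2.2.2.2.2]).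

(** Negated facts: prefixed to a clause, they turn it into an implication. *)
Definition premises (q : tm_state M) (r : reads) : seq template :=
  (false, (0, (n.+1, (false, (1, state_code q))))) ::
  [seq (false, (0, (val i, (false, (1, symbol_code (r i)))))) | i <- enum 'I_n.+1].

(** The new state, the written symbols, and the transport of unscanned cells, itself an implication
    for each possible content. *)
Definition conclusions (q : tm_state M) (r : reads) : seq (seq template) :=
  [:: (true, (1, (n.+1, (false, (1, state_code (next q r).1)))))] ::
  [seq [:: (true, (1, (val i, (false, (shift ((next q r).2 i).2, symbol_code
      ((next q r).2 i).1)))))]
     | i <- enum 'I_n.+1] ++
  [seq [:: (false, (0, (val z.1, (true, (1, symbol_code z.2)))));
           (true, (1, (val z.1, (true, (shift ((next q r).2 z.1).2, symbol_code z.2)))))]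
     | z <- enum {: 'I_n.+1 * option G}].

(** Depends on the machine only, hence a constant for the reduction, which merely instantiates it
    over times and cells. *)
Definition templates : seq (seq template) :=
  flatten [seq [seq premises z.1 z.2 ++ C | C <- conclusions z.1 z.2]
    | z <- enum {: tm_state M * reads}].

(* All sources [k.+1] but the head, whose content is overwritten. *)
Definition other_cells N := iota 0 N ++ [seq N.+1 + j | j <- iota 0 N].

Definition step_clauses N := flatten [seq flatten [seq
  [seq [seq instance N t k l | l <- C] | C <- templates] | k <- other_cells N] | t <- iota 0 N].

Definition blank := symbol_code None.
Definition guess := [:: blank; symbol_code (Some (inp (inr false)));
    symbol_code (Some (inp (inr true)))].

(** The input starts at the scanned cell [N.+1] and is followed by [B] guessed cells; cells beyond
    are blank through the default of [nth] in [init_clauses]. *)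
Definition allowed N B (xs : seq nat) : seq (seq nat) :=
  nseq N.+1 [:: blank] ++ ([seq [:: a] | a <- xs] ++ nseq B guess).

(** The last group propagates blanks to the right through the guessed cells, so that the certificate
    is a contiguous word. *)
Definition init_clauses N B (xs : seq nat) :=
  [:: lit true 0 n.+1 N.+1 (state_code (tm_start M))] ::
  ([seq [seq lit true 0 0 p a | a <- nth [:: blank] (allowed N B xs) p] | p <- iota 0
      (2 * N.+1)] ++
  (flatten [seq [seq [:: lit true 0 i p blank] | p <- iota 0 (2 * N.+1)] | i <- iota 1 n] ++
  [seq [:: lit false 0 0 (N.+1 + (size xs + j)) blank; lit true 0 0 (N.+1 +
      (size xs + j)).+1 blank]
     | j <- iota 0 B])).

(** Nonaccepting states are forbidden rather than an accepting one demanded: an assignment may hold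
    spurious facts, but the true state is always among those it affirms. *)
Definition final_clauses N :=
  [seq [:: lit false N n.+1 N.+1 a]
     | a <- [seq state_code q | q <- enum (tm_state M) & q \notin @tm_accept _ M]].

Definition tableau N B (xs : seq nat) : seq (seq (bool * seq nat)) :=
  step_clauses N ++ (init_clauses N B xs ++ final_clauses N).

Lemma pt_tableau A (T P : {poly nat}) :
  pt A (fun xs => tableau T.[(size xs + P.[size xs]%R)%N]%R P.[size xs]%R xs).
Proof.
rewrite /tableau /step_clauses /init_clauses /final_clauses /allowed /other_cells /instance /lit.
by rewrite /template; pt_auto.
Qed.

(** * From satisfying assignments to accepting runs *)

Section Soundness.
Variables (N B : nat) (x : seq Sg) (al : seq nat -> bool).
Let xs := [seq symbol_code (Some (inp (inl a))) | a <- x].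
Hypothesis sat : satisfies al (tableau N B xs).
Let m := size x.

Lemma size_xs : size xs = m. Proof. exact: size_map. Qed.

Lemma sat_in C : C \in tableau N B xs -> has (fun l => al l.2 == l.1) C.
Proof. by move/allP: sat; apply. Qed.

(* [cert] is the certificate read off from the assignment [al]. *)
Definition cert_blank j := al [:: 0; 0; N.+1 + (m + j); blank].
Definition cert_len := find cert_blank (iota 0 B).
Definition cert := [seq al [:: 0; 0; N.+1 + (m + j); symbol_code (Some (inp
    (inr true)))] | j <- iota 0 cert_len].

Lemma cert_len_le : cert_len <= B.
Proof. by rewrite /cert_len -[X in _ <= X](size_iota 0 B) find_size. Qed.

Lemma size_cert : size cert = cert_len. Proof. by rewrite size_map size_iota. Qed.

Let run t := tm_run M t [seq inp z | z <- [seq inl a | a <- x] ++ [seq inr b | b <- cert]].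

Lemma cert_nonblank j : j < cert_len -> cert_blank j = false.
Proof.
move=> h; have := before_find 0 h; rewrite nth_iota ?add0n //.
exact: leq_trans h cert_len_le.
Qed.

Lemma cert_blank_up j : cert_len <= j -> j < B -> cert_blank j.
Proof.
elim: j => [|j IH] h hB.
  have hh : has cert_blank (iota 0 B) by rewrite has_find size_iota; apply: leq_ltn_trans hB.
  have := nth_find 0 hh; rewrite nth_iota -/cert_len ?add0n; last by apply: leq_ltn_trans hB.
  by move: h; rewrite leqn0 => /eqP ->.
move: h; rewrite leq_eqVlt => /orP[/eqP h|h].
  have hh : has cert_blank (iota 0 B) by rewrite has_find size_iota -/cert_len h.
  by have := nth_find 0 hh; rewrite nth_iota -/cert_len h ?add0n.
have {}IH := IH h (ltnW hB).
have /sat_in : [:: lit false 0 0 (N.+1 + (m + j)) blank; lit true 0 0 (N.+1 + (m + j)).+1 blank]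
    \in tableau N B xs.
  rewrite !mem_cat; apply/orP; right; apply/orP; left; rewrite inE !mem_cat.
  do 3 (apply/orP; right); apply/mapP; exists j; rewrite ?size_xs // mem_iota add0n.
  exact: ltnW.
by move: IH; rewrite /cert_blank /= => -> /=; rewrite orbF !addnS => /eqP.
Qed.

Lemma init_facts i p : p < 2 * N.+1 ->
  al [:: 0; val i; p; symbol_code (cell N (ctapes (run 0) i) p)].
Proof.
move=> hp; rewrite /run /tm_run /= -val_eqE /=.
case: (posnP i) => [-> | hi] /=; last first.
  have -> : cell N (blank_tape G) p = None by rewrite /cell !nth_nil if_same.
  have /sat_in : [:: lit true 0 (val i) p blank] \in tableau N B xs.
    rewrite !mem_cat; apply/orP; right; apply/orP; left; rewrite inE !mem_cat.
    do 2 (apply/orP; right); apply/orP; left; apply/flattenP.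
    exists [seq [:: lit true 0 (val i) p blank] | p <- iota 0 (2 * N.+1)].
      by apply: (map_f (fun i => [seq [:: lit true 0 i p blank] | p <- iota 0 (2 * N.+1)]));
          rewrite mem_iota hi add1n ltn_ord.
    by apply: (map_f (fun p => [:: lit true 0 (val i) p blank])); rewrite mem_iota.
  by rewrite /= orbF => /eqP.
have /sat_in : [seq lit true 0 0 p a | a <- nth [:: blank] (allowed N B xs) p] \in tableau N B xs.
  rewrite !mem_cat; apply/orP; right; apply/orP; left; rewrite inE !mem_cat.
  apply/orP; right; apply/orP; left.
  by apply: (map_f (fun p => [seq lit true 0 0 p a | a <- nth [:: blank] (allowed N B xs) p]));
      rewrite mem_iota.
rewrite /allowed nth_cat size_nseq nth_nseq /cell ltnS.
case: leqP => h; first by rewrite nth_nil /= orbF => /eqP.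
have [j ->] : exists j, p = N.+1 + j by exists (p - N.+1); rewrite subnKC.
rewrite addKn nth_cat size_map size_xs /= {h}.
set y := symbol_code _.
have -> : y = nth blank (xs ++ [seq symbol_code (Some (inp (inr b))) | b <- cert]) j.
  by rewrite /y -(nth_map_default symbol_code) !map_cat -!map_comp.
rewrite nth_cat size_xs {y}.
case: (ltnP j m) => hj.
  rewrite (nth_map 0) ?size_xs //= orbF (set_nth_default 0) ?size_xs // => /eqP.
  by [].
have [J ->] : exists J, j = m + J by exists (j - m); rewrite subnKC.
rewrite addKn nth_nseq; case: (ltnP J cert_len) => hJ.
  rewrite (leq_trans hJ cert_len_le) (nth_map false) ?size_cert //.
  rewrite /cert (nth_map 0) ?size_iota // nth_iota // add0n.
  have /= := cert_nonblank hJ; rewrite /cert_blank => -> /=; rewrite orbF.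
  (* The certificate bit is the value of [al] on the symbol for [true]; if that value is false, the
     guess clause in a nonblank cell forces the symbol for [false]. *)
  set b := al (_ :: _ :: _ :: symbol_code (Some (inp (inr true))) :: _); move: (erefl b);
      rewrite {1}/b; case: b => hb /=; first by rewrite hb.
  by rewrite orbF => /eqP.
rewrite nth_default ?size_map ?size_iota //; case: ltnP => hB /=.
  by move=> _; apply: cert_blank_up.
by rewrite orbF => /eqP.
Qed.

Lemma step_sat t k C q r : t < N -> k \in other_cells N -> C \in conclusions q r ->
  al [:: t; n.+1; N.+1; state_code q] ->
  (forall i : 'I_n.+1, al [:: t; val i; N.+1; symbol_code (r i)]) ->
  has (fun l => al l.2 == l.1) [seq instance N t k l | l <- C].
Proof.
move=> ht hk hC hq hr.
have /sat_in : [seq instance N t k l | l <- premises q r ++ C] \in tableau N B xs.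
  rewrite mem_cat; apply/orP; left; apply/flattenP.
  exists (flatten [seq [seq [seq instance N t k l | l <- C] | C <- templates] | k <- other_cells
      N]).
    by apply: (map_f (fun t => flatten [seq [seq [seq instance N t k l | l <- C] | C <-
        templates] | k <- other_cells N])); rewrite mem_iota.
  apply/flattenP; exists [seq [seq instance N t k l | l <- C] | C <- templates].
    exact: (map_f (fun k => [seq [seq instance N t k l | l <- C] | C <- templates])).
  apply: map_f; apply/flattenP; exists [seq premises q r ++ C | C <- conclusions q r].
    by apply: (map_f (fun z => [seq premises z.1 z.2 ++ C | C <- conclusions z.1 z.2])) (_ :
        (q, r) \in _); rewrite mem_enum.
  exact: map_f.
rewrite map_cat has_cat => /orP[|//].
rewrite /= /instance /= addn0 addn1 hq /= => /hasP [_ /mapP [_ /mapP [i _ ->] ->]] /=.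
by rewrite addn0 addn1 hr.
Qed.

(** A step moves contents by at most one cell, so the window of known cells loses one cell per side
    at each step. It still contains the head cell [N.+1] at time [N]. *)
Lemma tableau_facts t : t <= N -> al [:: t; n.+1; N.+1; state_code (cstate (run t))] /\
  forall (i : 'I_n.+1) p, t < p -> p + t < 2 * N.+1 ->
    al [:: t; val i; p; symbol_code (cell N (ctapes (run t) i) p)].
Proof.
elim: t => [|t IH] ht.
  split; last by move=> i p _ hp; apply: init_facts; rewrite addn0 in hp.
  have /sat_in : [:: lit true 0 n.+1 N.+1 (state_code (tm_start M))] \in tableau N B xs.
    rewrite !mem_cat; apply/orP; right; apply/orP; left; rewrite inE.
    by rewrite eqxx.
  by rewrite /= orbF => /eqP.
have [IHs IHc] := IH (ltnW ht).
have hr (i : 'I_n.+1) : al [:: t; val i; N.+1; symbol_code (scan (run t) i)].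
  by rewrite ffunE -(cell_head N); apply: IHc; lia.
(* Clauses for the state and the written symbol do not mention [k], so any available index serves
   for them. *)
have k0 : 0 \in other_cells N by rewrite mem_cat mem_iota /= add0n (leq_ltn_trans _ ht).
have eS : run t.+1 = tm_step (run t) by rewrite /run /tm_run iterS.
set q := cstate (run t) in IHs; set r := scan (run t) in hr.
split.
  rewrite eS step_state -/q -/r.
  have := @step_sat t 0 _ q r ht k0 (mem_head _ _) IHs hr.
  by rewrite /= /instance /= !addn1 orbF => /eqP.
move=> i p h1 h2; rewrite eS.
pose a := (next q r).2 i.
have hs : shift a.2 <= 2 by case: (a.2).
(* The window forces [p >= 2], so the subtraction is exact and yields the source cell [k.+1]. *)
have hp : p = (p - shift a.2) + shift a.2 by rewrite subnK; lia.
move: hp; set k := p - shift a.2 => hp; rewrite hp step_cell -/q -/r -/a.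
case: eqP => hk.
  have := @step_sat t 0 [:: (true, (1, (val i, (false, (shift a.2, symbol_code a.1)))))] q r ht
      k0 _ IHs hr.
  rewrite /= /instance /= !addn1 orbF hk => H; apply/eqP/H.
  rewrite inE mem_cat; apply/orP; right; apply/orP; left.
  by apply: (map_f (fun i => [:: (true, (1, (val i, (false, (shift
      ((next q r).2 i).2, symbol_code ((next q r).2 i).1)))))])); rewrite mem_enum.
pose b := cell N (ctapes (run t) i) k.+1.
have hkN : k \in other_cells N.
  rewrite mem_cat mem_iota /= add0n; case: (ltnP k N) => //= h3.
  by apply/mapP; exists (k - N.+1); rewrite ?mem_iota; lia.
have hb : al [:: t; val i; k.+1; symbol_code b] by apply: IHc; lia.
have := @step_sat t k [:: (false, (0, (val i, (true, (1, symbol_code b)))));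
           (true, (1, (val i, (true, (shift a.2, symbol_code b)))))] q r ht hkN _ IHs hr.
rewrite /= /instance /= !addn1 addn0 hb /= orbF => H; apply/eqP/H.
rewrite inE mem_cat; apply/orP; right; apply/orP; right.
by apply: (map_f (fun z => [:: (false, (0, (val z.1, (true, (1, symbol_code z.2)))));
           (true, (1, (val z.1, (true, (shift ((next q r).2 z.1).2, symbol_code z.2)))))]) (_ :
               (i, b) \in _)); rewrite mem_enum.
Qed.

Lemma tableau_sound : accepting (run N).
Proof.
case: (boolP (accepting _)) => // h.
have [hs _] := tableau_facts (leqnn N).
have /sat_in : [:: lit false N n.+1 N.+1 (state_code (cstate (run N)))] \in tableau N B xs.
  rewrite !mem_cat; apply/orP; right; apply/orP; right.
  by apply/map_f/map_f; rewrite mem_filter mem_enum andbT.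
by rewrite /= hs.
Qed.

End Soundness.

(** * From accepting runs to satisfying assignments *)

Section Completeness.
Variables (N B : nat) (x : seq Sg) (y : seq bool).
Hypothesis size_y : size y <= B.
Let xs := [seq symbol_code (Some (inp (inl a))) | a <- x].
Let run t := tm_run M t [seq inp z | z <- [seq inl a | a <- x] ++ [seq inr b | b <- y]].
Hypothesis acc : accepting (run N).

Definition history (v : seq nat) : bool :=
  if v is [:: t; i; p; a] then
    if i == n.+1 then a == state_code (cstate (run t))
    else a == symbol_code (cell N (ctapes (run t) (inord i)) p)
  else false.
Arguments history v : simpl never.

Lemma history_state t p a : history [:: t; n.+1; p; a] = (a == state_code (cstate (run t))).
Proof. by rewrite /history eqxx. Qed.

Lemma history_cell t (i : 'I_n.+1) p a :
  history [:: t; val i; p; a] = (a == symbol_code (cell N (ctapes (run t) i) p)).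
Proof. by rewrite /history /= ltn_eqF ?ltn_ord // inord_val. Qed.

(** If the state or the reads of the template differ from the actual ones, a negated premise holds;
    otherwise the conclusion describes the actual step. *)
Lemma history_step t k C : C \in templates -> k \in other_cells N ->
  has (fun l => history l.2 == l.1) [seq instance N t k l | l <- C].
Proof.
move=> /flattenP [_ /mapP [[q r] _ ->] /mapP [C0 hC ->]] hk /=.
have {}hk : k == N = false.
  apply/negbTE; apply: contraTneq hk => ->; rewrite mem_cat mem_iota ltnn andbF /=.
  by apply/negP => /mapP [j]; lia.
rewrite map_cat has_cat.
case: (boolP (q == cstate (run t))) => [/eqP Eq|hq]; last first.
  apply/orP; left; rewrite /instance /= addn0 history_state.
  apply/eqP/negbTE; apply: contraNneq hq => h.
  by rewrite -(nth_index q (mem_enum _ q)) -/(state_code q) h nth_index ?mem_enum.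
case: (boolP (r == scan (run t))) => [/eqP Er|hr]; last first.
  apply/orP; right; apply/orP; left; rewrite -map_comp.
  case: (boolP [forall i, r i == scan (run t) i]) => [/forallP h|].
    by case/eqP: hr; apply/ffunP => i; apply/eqP.
  rewrite negb_forall => /existsP [i hi].
  apply/hasP; eexists; first by apply: (map_f _ (mem_enum _ i)).
  rewrite /instance /= addn0 addn1 history_cell cell_head.
  by apply/eqP/negbTE; apply: contraNneq hi => /symbol_code_inj ->; rewrite ffunE.
apply/orP; right; apply/orP; right; move: hC; rewrite {}Eq {}Er.
have eS : run t.+1 = tm_step (run t) by rewrite /run /tm_run iterS.
rewrite inE mem_cat => /orP[/eqP ->|/orP[/mapP [i _ ->]|/mapP [[i b] _ ->]]].
- by rewrite /= /instance /= addn1 history_state eS step_state eqxx.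
- rewrite /= /instance /= !addn1 history_cell eS.
  by have := step_cell N (run t) i N; rewrite eqxx => ->; rewrite eqxx.
- rewrite /= /instance /= !addn1 addn0 !history_cell eS.
  have := step_cell N (run t) i k; rewrite hk => ->.
  by case: (symbol_code b == _).
Qed.

Lemma tableau_complete : satisfies history (tableau N B xs).
Proof.
have sxs : size xs = size x by rewrite size_map.
rewrite /satisfies !all_cat; apply/and3P; split; apply/allP => C.
- move=> /flattenP [_ /mapP [t _ ->] /flattenP [_ /mapP [k hk ->] /mapP [C0 hC ->]]].
  exact: history_step.
- have c0 p : cell N (ctapes (run 0) ord0) p =
      if p <= N then None else nth None (map Some [seq inp z | z <- [seq inl a | a <- x] ++ [seq
          inr b | b <- y]]) (p - N.+1).
    by rewrite /run /tm_run /= /cell /= nth_nil.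
  have gcx j : symbol_code (nth None (map Some [seq inp z | z <- [seq inl a | a <- x] ++ [seq inr
      b | b <- y]]) j) =
      nth blank (xs ++ [seq symbol_code (Some (inp (inr b))) | b <- y]) j.
    by rewrite -(nth_map_default symbol_code) !map_cat -!map_comp.
  rewrite /init_clauses in_cons !mem_cat => /orP[/eqP ->|/orP[/mapP [p hp ->]|/orP[/flattenP [_
      /mapP [i hi ->] /mapP [p hp ->]]|/mapP [j hj ->]]]].
  + by rewrite /= history_state eqxx.
  + suff : symbol_code (cell N (ctapes (run 0) ord0) p) \in nth [:: blank] (allowed N B xs) p.
      move=> h; apply/hasP; exists (lit true 0 0 p (symbol_code (cell N (ctapes
          (run 0) ord0) p))); first exact: map_f.
      by rewrite (history_cell 0 ord0) eqxx.
    rewrite c0 /allowed nth_cat size_nseq nth_nseq ltnS; case: leqP => [_|hN];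
        first by rewrite inE.
    rewrite gcx !nth_cat (size_map (cons^~ [::]) xs) sxs.
    case: ltnP => h1; first by rewrite (nth_map blank [:: blank]) ?sxs ?inE.
    rewrite nth_nseq; case: ltnP => h2.
      case: (ltnP (p - N.+1 - size x) (size y)) => h3.
        rewrite (nth_map false) //; case: (nth _ _ _); by rewrite !inE eqxx ?orbT.
      by rewrite nth_default ?size_map ?inE ?eqxx.
    by rewrite nth_default ?size_map ?inE ?eqxx // (leq_trans size_y).
  + move: hi; rewrite mem_iota add1n => /andP[hi0 hi].
    rewrite /= orbF (history_cell 0 (Ordinal hi)) /run /tm_run /= -val_eqE /= (gtn_eqF hi0).
    by rewrite /cell !nth_nil if_same eqxx.
  + have H p a : history [:: 0; 0; p; a] = (a == symbol_code (cell N (ctapes (run 0) ord0) p)).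
      exact: (history_cell 0 ord0).
    rewrite [has _ _]/= orbF !H !c0 {H}; set s := size xs.
    have -> : (N.+1 + (s + j) <= N) = false by lia.
    have -> : ((N.+1 + (s + j)).+1 <= N) = false by lia.
    have -> : N.+1 + (s + j) - N.+1 = s + j by lia.
    have -> : (N.+1 + (s + j)).+1 - N.+1 = s + j.+1 by lia.
    rewrite !gcx !nth_cat -/s !ltnNge !leq_addr !addKn /=.
    case: (ltnP j (size y)) => h; last first.
      by rewrite [X in _ || (_ == X == _)]nth_default ?size_map ?eqxx ?orbT // leqW.
    (* Within the certificate the symbol is never blank, so the premise of the propagation clause
       fails. *)
    rewrite (nth_map false) //; apply/orP; left.
    by apply/eqP/negbTE/eqP => /symbol_code_inj.
- move=> /mapP [a /mapP [q]]; rewrite mem_filter => /andP[hq _] -> -> /=.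
  rewrite history_state orbF; apply/eqP/negbTE; apply: contraNneq hq => h.
  rewrite -(nth_index (tm_start M) (mem_enum _ q)) -/(state_code q) h nth_index ?mem_enum //.
Qed.
End Completeness.
End CookLevin.

(** The coefficients are natural numbers, so nothing is subtracted. *)
Lemma horner_mono (p : {poly nat}) a b : a <= b -> p.[a]%R <= p.[b]%R.
Proof.
move=> h; elim/poly_ind: p => [|p c IH]; first by rewrite !horner0.
by rewrite !hornerMXaddC leq_add2r leq_mul.
Qed.

Lemma tm_run_halted (G : finType) (M : TM G) w s t :
  halted (tm_run M s w) -> s <= t -> tm_run M t w = tm_run M s w.
Proof.
move=> h /subnK <-; rewrite /tm_run iterD -/(tm_run M s w).
by elim: (t - s) => //= k ->; rewrite /tm_step; move: h; rewrite /halted => ->.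
Qed.

Theorem overlap_extension_NP_hard : NP_hard overlap_extension.
Proof.
move=> Sg L' [V [P [[G [inp [M [T [inp_inj hM]]]]] hL]]].
pose xc (a : Sg) := symbol_code (G := G) (Some (inp (inl a))).
(* The running time is taken for the longest admissible certificate; on shorter ones the machine has
   halted by then and keeps its answer. *)
pose tab xs := tableau inp M T.[(size xs + P.[size xs]%R)%N]%R P.[size xs]%R xs.
pose f (x : seq Sg) := encode bit comma hash (family_cnf (tab (map xc x))).
exists f; split.
  apply: (@pt_polytime Sg oe_symbol _ xc (fun xs => encode_nat (family_cnf (tab xs)))).
    by move=> w; apply: map_code_encode.
  apply: pt_encode; apply: (pt_comp (g := fun phi : seq (seq (bool * seq nat)) => family_cnf
      phi)).
    exact: pt_family_cnf.
  exact: pt_tableau.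
move=> x; rewrite /f -family_cnf_correct.
set N := T.[(size (map xc x) + P.[size (map xc x)]%R)%N]%R.
have run_N y : size y <= P.[size x]%R ->
    accepting (tm_run M N (map inp (map inl x ++ map inr y))) <-> V (map inl x ++ map inr y).
  move=> hy; have [hh <-] := hM (map inl x ++ map inr y).
  rewrite (tm_run_halted hh) // /N size_map; apply: horner_mono.
  by rewrite size_cat !size_map leq_add2l.
rewrite hL; split=> [[y [hy hV]]|[al sat]].
  exists (history inp M N x y).
  rewrite /tab -/N; apply: tableau_complete; first by rewrite size_map.
  exact/(run_N y hy).
have hy := @cert_len_le Sg G N P.[size x]%R x al.
exists (@cert Sg G inp N P.[size x]%R x al); rewrite size_cert; split=> //.
apply/run_N; first by rewrite size_cert.
apply: (tableau_sound (M := M)); move: sat; rewrite /tab -/N size_map; exact.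
Qed.

Theorem theorem18 : NP_complete overlap_extension.
Proof. exact: conj overlap_extension_in_NP overlap_extension_NP_hard. Qed.
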